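(* Let $N\ge2$, let $\Omega\subset\mathbb R^N$ be an open, bounded set with Lipschitz boundary and $0\in\Omega$. Let $1<p<q<N$ with $\frac qp<1+\frac1N$, and let $a:\overline\Omega\to[0,\infty)$ be Lipschitz continuous and satisfy $a(\lambda x)\le a(x)$ for any $\lambda\in(0,1]$ and any $x\in\overline\Omega$. Then, for any $u\in W^{1,\mathcal H}_0(\Omega)$, $$H_p\int_\Omega\frac{|u|^p}{|x|^p}\,dx\le\int_\Omega|\nabla u|^p\,dx\qquad\text{and}\qquad H_q\int_\Omega a(x)\frac{|u|^q}{|x|^q}\,dx\le\int_\Omega a(x)|\nabla u|^q\,dx.$$
   Context: Hardy constants: $H_m:=\left(\frac{m}{N-m}\right)^{-m}$ for $m=p$ and $m=q$. Convention: in the condition $a(\lambda x)\le a(x)$, the function $a$ is trivially extended by $0$ outside $\overline\Omega$, so that $a(\lambda x)$ makes sense when $\lambda x\notin\overline\Omega$. Function spaces: let $\mathcal H(x,t)=t^p+a(x)t^q$ for $x\in\Omega$, $t\ge0$, and $\varrho_{\mathcal H}(u)=\int_\Omega(|u|^p+a(x)|u|^q)\,dx$. The Musielak-Orlicz space is $L^{\mathcal H}(\Omega)=\{u:\Omega\to\mathbb R\text{ measurable}:\varrho_{\mathcal H}(u)<\infty\}$ with the Luxemburg norm $\|u\|_{\mathcal H}=\inf\{\lambda>0:\varrho_{\mathcal H}(u/\lambda)\le1\}$. $W^{1,\mathcal H}(\Omega)=\{u\in L^{\mathcal H}(\Omega):|\nabla u|\in L^{\mathcal H}(\Omega)\}$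 with norm $\|u\|_{1,\mathcal H}=\|u\|_{\mathcal H}+\|\,|\nabla u|\,\|_{\mathcal H}$, and $W^{1,\mathcal H}_0(\Omega)$ is the completion of $C_0^\infty(\Omega)$ in $W^{1,\mathcal H}(\Omega)$, endowed with the equivalent norm $\|u\|=\|\,|\nabla u|\,\|_{\mathcal H}$. *)

(* Defs.v *)
From HB Require Import structures.
From mathcomp Require Import all_boot all_order all_algebra.
From mathcomp Require Import all_classical all_reals all_analysis.
Set Implicit Arguments.
Unset Strict Implicit.
Unset Printing Implicit Defensive.
Import Order.TTheory GRing.Theory Num.Theory.
Import numFieldNormedType.Exports.
Local Open Scope classical_set_scope.
Local Open Scope ring_scope.

Definition rV_display : measure_display.
Proof. exact: default_measure_display. Qed.

(* The Borel sigma-algebra of R^n, generated by the coordinates. *)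
Section rV_measurable.
Context (R : realType) (n : nat).

Let coord (i : 'I_n) (x : 'rV[R]_n) : measurableTypeR R := x ord0 i.

Let rV_set0 : g_sigma_preimage coord set0.
Proof. exact: sigma_algebra0. Qed.

Let rV_setC A : g_sigma_preimage coord A -> g_sigma_preimage coord (~` A).
Proof. exact: sigma_algebraC. Qed.

Let rV_bigcup (F : _^nat) : (forall i, g_sigma_preimage coord (F i)) ->
  g_sigma_preimage coord (\bigcup_i (F i)).
Proof. exact: sigma_algebra_bigcup. Qed.

HB.instance Definition _ := @isMeasurable.Build rV_display
  'rV[R]_n (g_sigma_preimage coord) rV_set0 rV_setC rV_bigcup.

Lemma measurable_coord_rV (i : 'I_n) :
  measurable_fun [set: 'rV[R]_n]
    (fun x : 'rV[R]_n => x ord0 i : measurableTypeR R).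
Proof.
move=> _ Y mY; rewrite setTI; apply: sub_sigma_algebra => /=.
rewrite -bigcup_seq/=; exists i => /=; first by rewrite mem_index_enum.
by exists Y => //; rewrite setTI.
Qed.

Lemma measurable_fun_rVP d (T : measurableType d) (f : T -> 'rV[R]_n) :
  (forall i, measurable_fun [set: T]
    (fun t => f t ord0 i : measurableTypeR R)) ->
  measurable_fun [set: T] f.
Proof.
move=> mf; apply: (@measurability _ _ _ _ _ _
  (\big[setU/set0]_(i < n) preimage_set_system setT (coord i) measurable)) => //.
move=> _ [B /= + <-]; rewrite -bigcup_seq => -[i _] [A mA <-].
by rewrite !setTI; have := mf i measurableT _ mA; rewrite setTI.
Qed.

End rV_measurable.

Section lebesgue_rV_step.
Context (R : realType) (n : nat).
Variable mu : {sigma_finite_measure set 'rV[R]_n -> \bar R}.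

Definition rV_cons (z : measurableTypeR R * 'rV[R]_n) : 'rV[R]_n.+1 :=
  \row_i oapp (z.2 ord0) z.1 (unlift ord0 i).

Definition rV_uncons (x : 'rV[R]_n.+1) : measurableTypeR R * 'rV[R]_n :=
  (x ord0 ord0, \row_j x ord0 (lift ord0 j)).

Lemma rV_consK : cancel rV_cons rV_uncons.
Proof.
case=> z v; congr pair; first by rewrite mxE unlift_none.
by apply/rowP => j; rewrite !mxE liftK.
Qed.

Lemma measurable_rV_cons : measurable_fun setT rV_cons.
Proof.
apply: measurable_fun_rVP => i; case: (unliftP ord0 i) => [j|] ->.
- apply: (eq_measurable_fun
    (fun z : measurableTypeR R * 'rV[R]_n => z.2 ord0 j)) => [z _|].
    by rewrite mxE liftK.
  exact: (measurableT_comp (@measurable_coord_rV R n j)).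
- apply: (eq_measurable_fun fst) => // z _.
  by rewrite mxE unlift_none.
Qed.

Lemma measurable_rV_uncons : measurable_fun setT rV_uncons.
Proof.
apply/measurable_fun_pairP; split; first exact: measurable_coord_rV.
apply: measurable_fun_rVP => j.
apply: eq_measurable_fun (@measurable_coord_rV R n.+1 (lift ord0 j)) => x _.
by rewrite /= mxE.
Qed.

Definition lebesgue_rV_step : set 'rV[R]_n.+1 -> \bar R :=
  pushforward (lebesgue_measure \x mu)%E rV_cons.

Let step_meas : {measure set 'rV[R]_n.+1 -> \bar R} :=
  measure_function_pushforward__canonical__measure_function_Measure
    (lebesgue_measure \x mu)%E measurable_rV_cons.

Let step0 : lebesgue_rV_step set0 = 0%E.
Proof. exact: (measure0 step_meas). Qed.

Let step_ge0 A : (0 <= lebesgue_rV_step A)%E.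
Proof. exact: (measure_ge0 step_meas). Qed.

Let step_sigma_additive : semi_sigma_additive lebesgue_rV_step.
Proof. exact: (@measure_semi_sigma_additive _ _ _ step_meas). Qed.

HB.instance Definition _ := isMeasure.Build _ _ _ lebesgue_rV_step
  step0 step_ge0 step_sigma_additive.

Let step_sigma_finite : sigma_finite setT lebesgue_rV_step.
Proof.
have /sigma_finiteP[F [TF ndF Foo]] := sigma_finiteT (@lebesgue_measure R).
have /sigma_finiteP[G [TG ndG Goo]] := sigma_finiteT mu.
exists (fun k => rV_uncons @^-1` (F k `*` G k)).
  apply/esym; rewrite -preimage_bigcup -subTset => x _ /=.
  have [k _ Fk] : (\bigcup_k F k) (rV_uncons x).1 by rewrite -TF.
  have [l _ Gl] : (\bigcup_k G k) (rV_uncons x).2 by rewrite -TG.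
  exists (maxn k l) => //; split => /=.
    by move: Fk; exact/subsetPset/ndF/leq_maxl.
  by move: Gl; exact/subsetPset/ndG/leq_maxr.
move=> k; have [mF Fk] := Foo k; have [mG Gk] := Goo k; split.
  rewrite -[X in measurable X]setTI; apply: measurable_rV_uncons => //.
  exact: measurableX.
rewrite /lebesgue_rV_step /pushforward -comp_preimage.
rewrite (_ : rV_uncons \o rV_cons = id); last exact/funext/rV_consK.
by rewrite preimage_id product_measure1E// lte_mul_pinfty// ge0_fin_numE.
Qed.

HB.instance Definition _ := Measure_isSigmaFinite.Build _ _ _
  lebesgue_rV_step step_sigma_finite.

End lebesgue_rV_step.

(* The n-fold product of the Lebesgue measure of R, on Borel sets. *)
Fixpoint borel_lebesgue_rV (R : realType) (n : nat) :
    {sigma_finite_measure set 'rV[R]_n -> \bar R} :=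
  if n is m.+1 then lebesgue_rV_step (borel_lebesgue_rV R m)
  else \d_(0 : 'rV[R]_0).

(* R^n with its Lebesgue sigma-algebra, i.e. the sets that are measurable in
   the sense of Caratheodory; as a type, it is 'rV[R]_n. *)
Definition lebesgue_rV_type (R : realType) (n : nat) :=
  caratheodory_type (borel_lebesgue_rV R n)^*%mu.

Definition lebesgue_rV (R : realType) (n : nat) :
    {measure set (lebesgue_rV_type R n) -> \bar R} :=
  @completed_measure_extension _ _ _ (borel_lebesgue_rV R n).

Section euclidean.
Context (R : realType) (n : nat).
Implicit Types (x y : 'rV[R]_n).

Definition dot x y : R := \sum_(i < n) x ord0 i * y ord0 i.

(* The library norm `|x| of a row vector is the sup norm. *)
Definition enorm x : R := Num.sqrt (dot x x).

(* Omega is locally the strict epigraph of a Lipschitz function. The graph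
   coordinates of x are its component along the unit vector e and its
   projection on the hyperplane orthogonal to e. *)
Definition lipschitz_boundary (Omega : set 'rV[R]_n) : Prop :=
  forall x0, (closure Omega `\` Omega°) x0 ->
  exists (e : 'rV[R]_n) (gamma : 'rV[R]_n -> R) (r : R),
    [/\ enorm e = 1, 0 < r,
        [lipschitz gamma y | y in [set y | dot e y = 0]] &
        forall x, enorm (x - x0) < r ->
          (Omega x <-> gamma (x - dot e x *: e) < dot e x)].

Definition partial (i : 'I_n) (f : 'rV[R]_n -> R) : 'rV[R]_n -> R :=
  fun x => 'D_(delta_mx ord0 i) f x.

Definition gradient (f : 'rV[R]_n -> R) (x : 'rV[R]_n) : 'rV[R]_n :=
  \row_i partial i f x.

Fixpoint is_Ck (k : nat) (f : 'rV[R]_n -> R) : Prop :=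
  continuous f /\
  if k is k'.+1 then
    forall i, (forall x, derivable f x (delta_mx ord0 i)) /\
              is_Ck k' (partial i f)
  else True.

(* C_0^oo(Omega), each function being extended by 0 to the whole space *)
Definition test_function (Omega : set 'rV[R]_n) (phi : 'rV[R]_n -> R) : Prop :=
  [/\ forall k, is_Ck k phi, compact (closure [set x | phi x != 0]) &
      closure [set x | phi x != 0] `<=` Omega].

End euclidean.

Section sobolev.
Context (R : realType) (n : nat).
Local Notation mu := (lebesgue_rV R n).
Local Notation E := (lebesgue_rV_type R n).
Variable Omega : set 'rV[R]_n.
Implicit Types (u f : 'rV[R]_n -> R) (g h : 'rV[R]_n -> 'rV[R]_n).

Definition locally_integrable_rV f : Prop :=
  measurable_fun (Omega : set E) (f : E -> R) /\
  forall K : set 'rV[R]_n, compact K -> K `<=` Omega ->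
    mu.-integrable K (EFin \o f).

Definition weak_gradient u g : Prop :=
  [/\ locally_integrable_rV u,
      forall i, locally_integrable_rV (fun x => g x ord0 i) &
      forall phi i, test_function Omega phi ->
        \int[mu]_(x in Omega) (u x * partial i phi x) =
        - \int[mu]_(x in Omega) (g x ord0 i * phi x)].

Variables (p q : R) (a : 'rV[R]_n -> R).

Definition double_phase (x : 'rV[R]_n) (t : R) : R := t `^ p + a x * t `^ q.

Definition modular f : \bar R :=
  (\int[mu]_(x in Omega) (double_phase x `|f x|)%:E)%E.

Definition musielak_orlicz f : Prop :=
  measurable_fun (Omega : set E) (f : E -> R) /\ (modular f < +oo)%E.

Definition luxemburg f : \bar R :=
  ereal_inf [set l%:E | l in
    [set l : R | 0 < l /\ (modular (fun x => f x / l)%R <= 1)%E]].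

(* Throughout, g stands for (a representative of) the weak gradient of u. *)
Definition W1H u g : Prop :=
  [/\ musielak_orlicz u, weak_gradient u g &
      musielak_orlicz (fun x => enorm (g x))].

Definition W1H_norm u g : \bar R :=
  (luxemburg u + luxemburg (fun x => enorm (g x)))%E.

(* The closure of C_0^oo(Omega) in W1H. *)
Definition W1H0 u g : Prop :=
  W1H u g /\
  exists phi : nat -> 'rV[R]_n -> R,
    (forall k, test_function Omega (phi k)) /\
    (fun k => W1H_norm (fun x => u x - phi k x)
                       (fun x => g x - gradient (phi k) x)) @ \oo --> 0%E.

End sobolev.

Definition hardy_const (R : realType) (N : nat) (m : R) : R :=
  (m / (N%:R - m)) `^ (- m).

(* Main.v *)
Require Import Defs.
From mathcomp Require Import all_boot all_order all_algebra.
From mathcomp Require Import all_classical all_reals all_analysis.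
From mathcomp Require Import measurable_realfun ring lra.
Set Implicit Arguments.
Unset Strict Implicit.
Unset Printing Implicit Defensive.
Import Order.TTheory GRing.Theory Num.Theory.
Import numFieldNormedType.Exports.
Local Open Scope classical_set_scope.
Local Open Scope ring_scope.

(** The inequality rests on integrating along the dilations [t |-> t *: x].
    Put [s = N / m], with [m] equal to [p] or [q]; then [1 < s] because
    [m < N].

    For a test function [phi] and a point [x], the function
    [h t = phi (t *: x)] vanishes for large [t], and
    [|h 1| `^ m * (s - 1) `^ (m - 1)] is at most the integral over [t >= 1] of
    [t `^ (s * (m - 1)) * |h' t| `^ m] ([powR_le_integral_ray]).  This is
    Young's inequality with the weight that the extremal profile
    [t `^ (1 - s)] dictates, followed by the fundamental theorem of calculus.
    As [|h' t| <= enorm x * enorm (gradient phi (t *: x))], dividing by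
    [enorm x `^ m] bounds the Hardy quotient of [phi] at [x] by an average of
    [enorm (gradient phi) `^ m] over the ray through [x]
    ([hardy_pointwise]).  Multiply by the weight [w], integrate in [x] and
    exchange the integrals.  For a fixed [t >= 1], the substitution
    [y = t *: x] contributes the factor [t ^- N] and turns [w x] into
    [w (t^-1 *: y)], which the scaling hypothesis bounds by [w y].  What
    remains is the integral of [t `^ (- s)] over [t >= 1], equal to
    [(s - 1)^-1]; altogether the constant is [(s - 1) `^ (- m)], the inverse
    of [hardy_const N m] ([hardy_test_function]).

    The general case follows by density ([le_integral_powR_limit]): the
    Luxemburg norm controls the integrals of [|f| `^ p] and [a * |f| `^ q]
    separately ([luxemburg_lt]), hence errors measured with weight [w] tend to
    [0].  Truncating the singular weight makes these errors control the Hardy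
    term too, and monotone convergence removes the truncation.  The two
    inequalities are the instances [w = 1] and [w = a], the latter extended by
    [0] outside [Omega]. *)

(** * Borel sets and Lebesgue integrals of R^n *)

Lemma measurable_ball_rV (R : realType) n (c : 'rV[R]_n) (r : R) :
  measurable (ball c r : set 'rV[R]_n).
Proof.
have [r0|r0] := ltP 0 r; last first.
  rewrite (_ : ball c r = set0) //; apply/seteqP; split => // y.
  by case=> /lt_le_trans/(_ r0); rewrite ltxx.
rewrite (_ : ball c r =
    \bigcap_(j in [set: 'I_n]) [set y : 'rV[R]_n | `|c ord0 j - y ord0 j| < r]).
  apply: fin_bigcap_measurable => // j _.
  have -> : [set y : 'rV[R]_n | `|c ord0 j - y ord0 j| < r] =
      setT `&` (fun y : 'rV[R]_n => y ord0 j : measurableTypeR R) @^-1`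
        `](c ord0 j - r), (c ord0 j + r)[%classic.
    apply/seteqP; split => y /=; rewrite in_itv/= ltr_distlC; [by []|by case].
  exact: measurable_coord_rV.
apply/seteqP; split=> y /=; first by case=> _ H j _; exact: (H ord0 j).
by move=> H; split => // i j; rewrite ord1; exact: (H j I).
Qed.

(** [R^n] is second countable: an open set is the union of the balls with
    rational centre and radius that it contains. *)
Lemma open_measurable_rV (R : realType) n (A : set 'rV[R]_n) :
  open A -> measurable A.
Proof.
move=> oA.
pose B (z : 'rV[rat]_n * rat) : set 'rV[R]_n :=
  ball (map_mx ratr z.1 : 'rV[R]_n) (ratr z.2).
rewrite (_ : A = \bigcup_(z : 'rV[rat]_n * rat)
    if `[< B z `<=` A >] then B z else set0).
  apply: countable_bigcupT_measurable => // z.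
  by case: ifPn => // _; exact: measurable_ball_rV.
apply/seteqP; split => [x Ax|x [z _]]; last by case: asboolP => // BA Bx; exact: BA.
have /nbhs_ballP[e /= e0 eA] : nbhs x A by move: oA; rewrite openE; exact.
have e20 : 0 < e / 2 by rewrite divr_gt0.
have [q /[!in_itv]/= /andP[q0 qe]] := rat_in_itvoo e20.
have cP j : exists c : rat, ratr c \in `](x ord0 j - ratr q), (x ord0 j + ratr q)[.
  by apply: rat_in_itvoo; rewrite ltrD2l gtrN.
pose c : 'rV[rat]_n := \row_j xchoose (cP j).
have cx j : `|ratr (c ord0 j) - x ord0 j| < ratr q.
  by have := xchooseP (cP j); rewrite in_itv/= mxE distrC -ltr_distlC.
exists (c, q) => //.
have Bx : B (c, q) x.
  by split => // i j; rewrite ord1 mxE; exact: cx.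
rewrite asboolT // => y [_ By]; apply: eA; split => // i j; rewrite ord1.
have /= := By ord0 j; rewrite /ball/= mxE => cy.
have -> : x ord0 j - y ord0 j = - (ratr (c ord0 j) - x ord0 j) +
   (ratr (c ord0 j) - y ord0 j) by rewrite opprB addrA subrK.
rewrite (le_lt_trans (ler_normD _ _))// normrN.
by rewrite (splitr e) ltrD // (lt_trans _ qe).
Qed.

Lemma open_continuous_measurable_fun_rV (R : realType) n (D : set 'rV[R]_n)
    (f : 'rV[R]_n -> R) :
  open D -> {in D, continuous f} ->
  measurable_fun D (f : 'rV[R]_n -> measurableTypeR R).
Proof.
move=> oD cf; apply: (measurability _ (RGenOpens.measurableE R)).
move=> _ [_ [a [b ->] <-]]; apply: open_measurable_rV.
rewrite openE => x [Dx fx]; apply: filterI; first by move: oD; rewrite openE; exact.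
apply: (cf x (mem_set Dx)); apply: open_nbhs_nbhs.
by split => //; exact: interval_open.
Qed.

Lemma continuous_measurable_fun_rV (R : realType) n (f : 'rV[R]_n -> R) :
  continuous f -> measurable_fun setT (f : 'rV[R]_n -> measurableTypeR R).
Proof.
move=> cf; apply: open_continuous_measurable_fun_rV; first exact: openT.
by move=> x _; exact: cf.
Qed.

Lemma measurable_fun_enorm (R : realType) n d (T : measurableType d)
    (D : set T) (h : T -> 'rV[R]_n) :
  (forall i, measurable_fun D (fun x => h x ord0 i : R)) ->
  measurable_fun D (fun x => enorm (h x) : R).
Proof.
move=> mh.
apply: (measurableT_comp (continuous_measurable_fun (@sqrt_continuous R))) => /=.
by apply: measurable_sum => i; exact: measurable_funM.
Qed.

Lemma measurable_enorm (R : realType) n :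
  measurable_fun setT (@enorm R n : 'rV[R]_n -> measurableTypeR R).
Proof. by apply: measurable_fun_enorm => i; exact: measurable_coord_rV. Qed.

Lemma measurable_lebesgue_rV (R : realType) n (A : set 'rV[R]_n) :
  measurable A -> measurable (A : set (lebesgue_rV_type R n)).
Proof. by move=> mA; apply: sub_caratheodory; exact: sub_sigma_algebra. Qed.

Lemma measurable_fun_lebesgue_rV (R : realType) n d (T : measurableType d)
    (D : set 'rV[R]_n) (f : 'rV[R]_n -> T) :
  measurable D -> measurable_fun D f ->
  measurable_fun (D : set (lebesgue_rV_type R n)) f.
Proof. by move=> mD mf _ Y mY; apply: measurable_lebesgue_rV; exact: mf. Qed.

(** The Lebesgue measure restricts to its Borel version, which is the
    pushforward under the identity map.  The Borel version is the one built as
    a sigma-finite product, to which Tonelli's theorem applies. *)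
Lemma integral_lebesgue_rV (R : realType) n (D : set 'rV[R]_n)
    (f : 'rV[R]_n -> \bar R) :
  measurable D -> measurable_fun D f -> (forall x, D x -> 0 <= f x)%E ->
  (\int[lebesgue_rV R n]_(x in D) f x = \int[borel_lebesgue_rV R n]_(x in D) f x)%E.
Proof.
move=> mD mf f0.
have mid : measurable_fun setT (id : lebesgue_rV_type R n -> 'rV[R]_n).
  by move=> _ Y mY; rewrite setTI; exact: measurable_lebesgue_rV.
transitivity (\int[pushforward (lebesgue_rV R n)
    (id : lebesgue_rV_type R n -> 'rV[R]_n)]_(x in D) f x)%E.
  by rewrite (ge0_integral_pushforward mid)// => x /[!inE] /f0.
apply: eq_measure_integral => A mA _.
rewrite /pushforward /lebesgue_rV /completed_measure_extension.
exact: measurable_mu_extE.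
Qed.

(** * Dilations of the Lebesgue measure *)

(** Both [lebesgue_measure] and [l] times its pushforward under [l * _] give an
    interval its length, so they are equal. *)
Lemma ge0_integral_lebesgue_scale (R : realType) (l : R) (f : R -> \bar R) :
  0 < l -> measurable_fun setT f -> (forall x, 0 <= f x)%E ->
  (\int[lebesgue_measure]_x f (l * x)%R =
   l^-1%:E * \int[lebesgue_measure]_x f x)%E.
Proof.
move=> l0 mf f0.
have ml : measurable_fun [set: measurableTypeR R]
    (fun x : measurableTypeR R => l * x : measurableTypeR R).
  exact: measurable_funM.
pose l' := NngNum (ltW l0).
pose mu : {measure set (measurableTypeR R) -> \bar R} :=
  mscale l' (measure_function_pushforward__canonical__measure_function_Measure
    (@lebesgue_measure R) ml).
have -> : (\int[lebesgue_measure]_x f x = \int[mu]_x f x)%E.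
  apply: eq_measure_integral => A mA _.
  apply: (@lebesgue_measure_unique R mu) => // X [[a b] _ <-] /=.
  rewrite /mscale/= /pushforward.
  have -> : (fun x => l * x) @^-1` `]a, b] = `](l^-1 * a), (l^-1 * b)]%classic.
    apply/seteqP; split=> x /=; rewrite !in_itv/= ltr_pdivrMl// ler_pdivlMl//.
  rewrite !lebesgue_measure_itv/= !lte_fin ltr_pM2l ?invr_gt0//.
  case: ifPn => _; last by rewrite mule0.
  by rewrite -!EFinB -EFinM -mulrBr mulrA divff ?gt_eqF// mul1r.
rewrite ge0_integral_mscale//=.
rewrite (ge0_integral_pushforward ml)//=.
by rewrite muleA -EFinM mulVf ?gt_eqF// mul1e.
Qed.

Lemma measurable_scale_rV (R : realType) n (l : R) :
  measurable_fun setT (fun x : 'rV[R]_n => l *: x).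
Proof.
apply: measurable_fun_rVP => i.
apply: (eq_measurable_fun (fun x : 'rV[R]_n => l * x ord0 i)).
  by move=> x _; rewrite mxE.
by apply: measurable_funM => //; exact: measurable_coord_rV.
Qed.

(** Induction on the dimension: the measure on [R^n.+1] is a product, and
    Tonelli's theorem separates the dilation of the first coordinate from the
    dilation of the others. *)
Lemma ge0_integral_rV_scale (R : realType) n (l : R) (f : 'rV[R]_n -> \bar R) :
  0 < l -> measurable_fun setT f -> (forall x, 0 <= f x)%E ->
  (\int[borel_lebesgue_rV R n]_x f (l *: x)%R =
   (l ^- n)%:E * \int[borel_lebesgue_rV R n]_x f x)%E.
Proof.
move=> l0; elim: n f => [|n IH] f mf f0.
  rewrite expr0 invr1 mul1e; apply: eq_integral => x _; congr f.
  by apply/rowP => -[].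
have fubini (F : 'rV[R]_n.+1 -> \bar R) :
   measurable_fun setT F -> (forall x, 0 <= F x)%E ->
   (\int[borel_lebesgue_rV R n.+1]_x F x =
    \int[lebesgue_measure]_t \int[borel_lebesgue_rV R n]_v F (rV_cons (t, v)))%E.
  move=> mF F0; rewrite /= /lebesgue_rV_step.
  rewrite (ge0_integral_pushforward (@measurable_rV_cons R n))//.
  rewrite fubini_tonelli1//=.
  by apply: measurableT_comp => //; exact: measurable_rV_cons.
have mcons t : measurable_fun setT (fun v : 'rV[R]_n => f (rV_cons (t, v))).
  apply: measurableT_comp => //; apply: measurableT_comp => //.
  exact: measurable_rV_cons.
rewrite fubini//; last by apply: measurableT_comp => //; exact: measurable_scale_rV.
rewrite [in RHS]fubini//.
have consZ t v : l *: rV_cons (t, v) = rV_cons (l * t, l *: v) :> 'rV[R]_n.+1.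
  by apply/rowP => i; rewrite !mxE; case: unliftP => [j|] _ //=; rewrite mxE.
under eq_integral => t _ do under eq_integral do rewrite consZ.
under eq_integral => t _ do rewrite (IH (fun v => f (rV_cons (l * t, v))))//.
have mG : measurable_fun setT (fun t : measurableTypeR R =>
    \int[borel_lebesgue_rV R n]_v f (rV_cons (t, v)))%E.
  apply: (@measurable_fun_fubini_tonelli_F _ _ _ _ _ (borel_lebesgue_rV R n)
    (f \o @rV_cons R n)) => //.
  - by apply: measurableT_comp => //; exact: measurable_rV_cons.
  - by move=> z; exact: f0.
have ml : measurable_fun [set: measurableTypeR R]
    (fun x : measurableTypeR R => l * x : measurableTypeR R).
  exact: measurable_funM.
have mGl := measurableT_comp mG ml.
rewrite (ge0_integralZl _ measurableT mGl); last 2 first.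
- by move=> t _; exact: integral_ge0.
- by rewrite lee_fin invr_ge0; apply: exprn_ge0; exact: ltW.
rewrite (ge0_integral_lebesgue_scale l0 mG); last by move=> t; exact: integral_ge0.
by rewrite muleA -EFinM exprS invfM [in RHS]mulrC.
Qed.

(** * Directional derivatives and the Euclidean norm *)

Lemma is_derive_line (R : realType) n (f : 'rV[R]_n -> R) (y v : 'rV[R]_n) (t d : R) :
  is_derive (y + t *: v) v f d -> is_derive t (1 : R) (fun s => f (y + s *: v)) d.
Proof.
move=> [df dE].
have E : (fun h : R => h^-1 *: (f (y + (h *: (1 : R) + t) *: v) - f (y + t *: v))) =
   (fun h : R => h^-1 *: (f (h *: v + (y + t *: v)) - f (y + t *: v))).
  apply/funext => h; congr (_ *: (f _ - _)).
  by rewrite [h *: 1]mulr1 scalerDl addrCA.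
by split; [rewrite /derivable/= E|rewrite -dE /derive/= E].
Qed.

Lemma directional_MVT (R : realType) n (f : 'rV[R]_n -> R) (e : 'rV[R]_n) :
  (forall x, derivable f x e) -> forall (y : 'rV[R]_n) (s : R),
  exists2 t : R, `|t| <= `|s| & f (y + s *: e) - f y = s * 'D_e f (y + t *: e).
Proof.
move=> df y s.
pose g (t : R) := f (y + t *: e).
have dg t : is_derive t (1 : R) g ('D_e f (y + t *: e)).
  by apply: is_derive_line; exact: DeriveDef.
have cg (a b : R) : {within `[a, b], continuous g}.
  apply: continuous_subspaceT => t; apply: differentiable_continuous.
  by apply/derivable1_diffP; case: (dg t).
have g0 : g 0 = f y by rewrite /g scale0r addr0.
have [s0|s0] := leP 0 s.
  have [t] := MVT_segment s0 (fun t _ => dg t) (@cg _ _).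
  rewrite in_itv/= => /andP[t0 ts]; rewrite g0 subr0 => E; exists t.
    by rewrite !ger0_norm.
  by rewrite mulrC -E.
have [t] := MVT_segment (ltW s0) (fun t _ => dg t) (@cg _ _).
rewrite in_itv/= => /andP[st t0]; rewrite g0 sub0r => E; exists t.
  by rewrite !ler0_norm// ?lerN2// ltW.
by apply: oppr_inj; rewrite opprB E mulrN mulrC.
Qed.

(** The increment along [h *: (c *: e + w)] splits into the increment along
    [h *: w] from [x], which the derivative [d] describes, and an increment
    along [e] from the moving point [h *: w + x]. The mean value theorem and
    the continuity of ['D_e f] at [x] handle the second one. *)
Lemma is_derive_addZ (R : realType) n (f : 'rV[R]_n -> R) (e w x : 'rV[R]_n) (c d : R) :
  (forall y, derivable f y e) -> {for x, continuous ('D_e f)} ->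
  is_derive x w f d -> is_derive x (c *: e + w) f (c * 'D_e f x + d).
Proof.
move=> df cD [dw dE].
suff H : h^-1 *: (f (h *: (c *: e + w) + x) - f x) @[h --> (0 : R)^'] -->
    c * 'D_e f x + d.
  by split; [apply/cvg_ex; exists (c * 'D_e f x + d)|apply: cvg_lim].
have -> : (fun h : R => h^-1 *: (f (h *: (c *: e + w) + x) - f x)) =
  (fun h => h^-1 *: (f (h *: (c *: e + w) + x) - f (h *: w + x))) \+
  (fun h => h^-1 *: (f (h *: w + x) - f x)).
  by apply/funext => h /=; rewrite -scalerDr addrA subrK.
apply: cvgD; last by rewrite -dE; exact: dw.
apply/cvgrPdist_lt => eps eps0.
have c1 : 0 < `|c| + 1 by rewrite ltr_wpDl.
have /cvgrPdist_lt/(_ (eps / (`|c| + 1))) := cD.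
rewrite divr_gt0// => /(_ isT)/nbhs_ballP[r /= r0 rP].
have K0 : 0 < `|w| + `|c| * `|e| + 1 by rewrite ltr_wpDl// addr_ge0// mulr_ge0.
near=> h.
have h0 : h != 0 by near: h; exact: nbhs_dnbhs_neq.
have [t tle E] := directional_MVT df (h *: w + x) (h * c).
have -> : h *: (c *: e + w) + x = h *: w + x + (h * c) *: e.
  by rewrite scalerDr scalerA -addrA addrC.
rewrite E.
have -> : h^-1 *: (h * c * 'D_e f (h *: w + x + t *: e)) =
    c * 'D_e f (h *: w + x + t *: e).
  by rewrite /GRing.scale/= !mulrA mulVf// mul1r.
rewrite -mulrBr normrM (@le_lt_trans _ _ (`|c| * (eps / (`|c| + 1))))//; last first.
  by rewrite mulrCA gtr_pMr// ltr_pdivrMr// mul1r ltrDl.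
apply: ler_wpM2l => //; apply: ltW; apply: rP.
rewrite -ball_normE /= addrAC opprD addrCA subrr addr0.
rewrite normrN (le_lt_trans (ler_normD _ _))// !normrZ.
apply: (@le_lt_trans _ _ (`|h| * (`|w| + `|c| * `|e| + 1))).
  have te : `|t| * `|e| <= `|h| * `|c| * `|e| by rewrite -normrM ler_wpM2r.
  by have := normr_ge0 h; lra.
rewrite -ltr_pdivlMr//; near: h.
apply: dnbhs0_lt; exact: divr_gt0.
Unshelve. all: by end_near. Qed.

(** The coordinates of [v] are added one at a time with [is_derive_addZ]. *)
Lemma is_derive_gradient (R : realType) n (f : 'rV[R]_n -> R) (x v : 'rV[R]_n) :
  is_Ck 1 f -> is_derive x v f (dot v (gradient f x)).
Proof.
move=> [cf Cf]; rewrite {1}[v]row_sum_delta /dot.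
apply: (big_rec2 (fun w d => is_derive x w f d)) => [|i d w _ IH].
  exact: is_derive0.
have [di [ci _]] := Cf i.
by rewrite mxE; apply: is_derive_addZ; [exact: di|exact: ci].
Qed.

Lemma is_derive_ray (R : realType) n (f : 'rV[R]_n -> R) (x : 'rV[R]_n) (t : R) :
  is_Ck 1 f ->
  is_derive t (1 : R) (fun s => f (s *: x)) (dot x (gradient f (t *: x))).
Proof.
move=> Cf; have := is_derive_gradient (0 + t *: x) x Cf.
move=> /is_derive_line; rewrite add0r.
by under [in X in X -> _]eq_fun do rewrite add0r.
Qed.

Lemma dot_ge0 (R : realType) n (x : 'rV[R]_n) : 0 <= dot x x.
Proof. by apply: sumr_ge0 => i _; rewrite -expr2 sqr_ge0. Qed.

Lemma enorm_ge0 (R : realType) n (x : 'rV[R]_n) : 0 <= enorm x.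
Proof. exact: sqrtr_ge0. Qed.

Lemma sqr_enorm (R : realType) n (x : 'rV[R]_n) : enorm x ^+ 2 = dot x x.
Proof. by rewrite sqr_sqrtr// dot_ge0. Qed.

Lemma enorm_eq0 (R : realType) n (x : 'rV[R]_n) : (enorm x == 0) = (x == 0).
Proof.
apply/idP/eqP => [|->]; last first.
  by rewrite /enorm /dot big1 ?sqrtr0// => i _; rewrite mxE mul0r.
rewrite -sqrf_eq0 sqr_enorm psumr_eq0; last by move=> i _; rewrite -expr2 sqr_ge0.
move=> /allP H; apply/rowP => i; rewrite mxE; apply/eqP.
by have := H i (mem_index_enum i); rewrite /= mulf_eq0 orbb.
Qed.

Lemma dotZl (R : realType) n (c : R) (x y : 'rV[R]_n) : dot (c *: x) y = c * dot x y.
Proof. by rewrite /dot mulr_sumr; apply: eq_bigr => i _; rewrite mxE mulrA. Qed.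

Lemma dotC (R : realType) n (x y : 'rV[R]_n) : dot x y = dot y x.
Proof. by apply: eq_bigr => i _; rewrite mulrC. Qed.

Lemma dotDl (R : realType) n (x y z : 'rV[R]_n) : dot (x + y) z = dot x z + dot y z.
Proof. by rewrite /dot -big_split; apply: eq_bigr => i _; rewrite mxE mulrDl. Qed.

(** The Cauchy-Schwarz inequality, from the nonnegativity of [dot z z] for a
    vector [z] orthogonal to [x]. *)
Lemma ler_norm_dot (R : realType) n (x y : 'rV[R]_n) : `|dot x y| <= enorm x * enorm y.
Proof.
rewrite -[leLHS]sqrtr_sqr -sqrtrM ?dot_ge0// ler_wsqrtr//.
have [->|x0] := eqVneq x 0.
  have d0 z : dot 0 z = 0 :> R by rewrite /dot big1// => i _; rewrite mxE mul0r.
  by rewrite !d0 expr0n mul0r.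
have xx : 0 < dot x x by rewrite -sqr_enorm exprn_gt0// lt0r enorm_eq0 x0 enorm_ge0.
(* this vector is [dot x x] times the component of [y] orthogonal to [x] *)
have := dot_ge0 (dot x x *: y + (- dot x y) *: x).
rewrite !(dotDl, dotZl) ![dot _ (_ *: _ + _)]dotC !(dotDl, dotZl) [dot y x]dotC.
rewrite [X in 0 <= X](_ : _ = dot x x * (dot x x * dot y y - dot x y ^+ 2));
  last by ring.
by rewrite pmulr_rge0// subr_ge0.
Qed.

Lemma ler_enormD (R : realType) n (x y : 'rV[R]_n) : enorm (x + y) <= enorm x + enorm y.
Proof.
rewrite -(@ler_pXn2r _ 2)// ?nnegrE ?addr_ge0 ?enorm_ge0// sqrrD !sqr_enorm.
rewrite dotDl ![dot _ (_ + _)]dotC !dotDl [dot y x]dotC.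
have := le_trans (ler_norm _) (ler_norm_dot x y); lra.
Qed.

(** * The inequality along a ray *)

(** Young's inequality with a free parameter [b], an equality for [a = b]. *)
Lemma powR_young (R : realType) (p a b : R) : 1 < p -> 0 <= a -> 0 < b ->
  a <= p^-1 * (a `^ p * b `^ (1 - p)) + (1 - p^-1) * b.
Proof.
move=> p1 a0 b0; have p0 : 0 < p by exact: lt_trans p1.
set r := 1 - p^-1.
have r0 : 0 < r by rewrite subr_gt0 invf_lt1.
have := @conjugate_powR R (a * b `^ (- r)) (b `^ r) p r^-1.
rewrite invrK /r subrKC => H.
have := H (mulr_ge0 a0 (powR_ge0 _ _)) (powR_ge0 _ _) p0 _ erefl.
rewrite invr_gt0 => /(_ r0).
rewrite -mulrA -powRD ?(gt_eqF b0) ?implybT// addNr powRr0 mulr1.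
rewrite powRM ?powR_ge0// -!powRrM mulfV ?gt_eqF// powRr1 ?(ltW b0)//.
have -> : - (1 - p^-1) * p = 1 - p by rewrite mulNr mulrBl mul1r mulVf ?gt_eqF// opprB.
by rewrite mulrC [b * _]mulrC.
Qed.

(** Equality holds for the profile [h t = t `^ (1 - s)], whose derivative is
    [(1 - s) * t `^ (- s)].  Hence Young's inequality is applied to [|h' t|]
    with parameter [A * t `^ (- s)], where [A = |h 1| * (s - 1)] makes this the
    derivative, up to sign, of the profile that has the value [|h 1|] at [1]:
    after integration, the term of Young's inequality without [h'] is a fixed
    fraction of [|h 1|] and is absorbed by the left-hand side. *)
Lemma powR_le_integral_ray (R : realType) (p s T : R) (h h' : R -> R) :
  1 < p -> 1 < s -> (forall t, is_derive t (1 : R) h (h' t)) -> continuous h' ->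
  (forall t, T <= t -> h t = 0) ->
  ((`|h 1| `^ p * (s - 1) `^ (p - 1))%:E <=
   \int[lebesgue_measure]_(t in `[1%R, +oo[) (t `^ (s * (p - 1)) * `|h' t| `^ p)%:E)%E.
Proof.
move=> p1 s1 dh ch' hT; have p0 : 0 < p by exact: lt_trans p1.
set H := fun t => t `^ (s * (p - 1)) * `|h' t| `^ p.
have H0 (t : R) : 0 <= H t by rewrite mulr_ge0 ?powR_ge0.
have mH : measurable_fun setT H.
  apply: measurable_funM; first exact: measurable_powR.
  apply: (measurableT_comp (measurable_powR p)).
  by apply: measurableT_comp => //; exact: continuous_measurable_fun.
(* the parameter of Young's inequality has to be positive *)
have [h10|h1] := eqVneq (h 1) 0.
  rewrite h10 normr0 powR0 ?gt_eqF// mul0r.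
  by apply: integral_ge0 => t _; rewrite lee_fin; exact: H0.
set c : R := `|h 1|; have c0 : 0 < c by rewrite normr_gt0.
pose A : R := c * (s - 1); have A0 : 0 < A by rewrite mulr_gt0// subr_gt0.
pose U := Num.max T 2; have U1 : 1 < U by rewrite /U lt_max ltr1n orbT.
(* the sign makes [e * h] positive at 1 *)
pose e := Num.sg (h 1).
(* [F] contains the primitive of the absorbed term of Young's inequality *)
pose F t := e * h t - (c * (1 - p^-1)) * t `^ (1 - s).
pose F' t := e * h' t + (A * (1 - p^-1)) * t `^ (- s).
have dF (t : R) : 0 < t -> is_derive t (1 : R) F (F' t).
  move=> t0.
  have dp := is_derive1_powR (1 - s) t0.
  have -> : F = (e \*: h - (c * (1 - p^-1)) \*: (@powR R ^~ (1 - s))) by [].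
  apply: is_derive_eq.
  rewrite /F' /GRing.scale/=; have -> : 1 - s - 1 = - s by ring.
  by rewrite /A; ring.
have cpow (r t : R) : 0 < t -> {for t, continuous (@powR R ^~ r)}.
  move=> t0; apply: differentiable_continuous; apply/derivable1_diffP.
  by case: (is_derive1_powR r t0).
have cF' (t : R) : 0 < t -> {for t, continuous F'}.
  move=> t0; apply: cvgD; first by apply: cvgM; [exact: cvg_cst|exact: ch'].
  by apply: cvgM; [exact: cvg_cst|exact: cpow].
have cF (t : R) : 0 < t -> {for t, continuous F}.
  move=> t0; apply: differentiable_continuous; apply/derivable1_diffP.
  by case: (dF t t0).
have pos (t : R) : t \in `[1, U] -> 0 < t.
  by rewrite in_itv/= => /andP[t1 _]; exact: lt_le_trans t1.
have wF' : {within `[1, U], continuous F'}.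
  apply: continuous_in_subspaceT => t /[!inE] /pos; exact: cF'.
have FTC : (\int[lebesgue_measure]_(t in `[1%R, U]) (F' t)%:E = (F U)%:E - (F 1)%:E)%E.
  apply: continuous_FTC2 => //.
    split.
    - move=> t /[!in_itv]/= /andP[t1 _].
      by have [] := dF t (lt_trans ltr01 t1).
    - by apply: cvg_at_right_filter; exact: cF.
    - by apply: cvg_at_left_filter; apply: cF; exact: lt_trans U1.
  move=> t /[!in_itv]/= /andP[t1 _]; rewrite derive1E.
  by have [] := dF t (lt_trans ltr01 t1).
have F1 : F 1 = c * p^-1.
  rewrite /F powR1 /c normrEsg -/e; ring.
have FU : F U <= 0.
  rewrite /F hT ?mulr0 ?sub0r; last by rewrite /U le_max lexx.
  by rewrite oppr_le0 !mulr_ge0 ?powR_ge0 ?ltW// subr_gt0 invf_lt1.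
have low : ((c * p^-1)%:E <= \int[lebesgue_measure]_(t in `[1%R, U]) (- F' t)%:E)%E.
  have -> : (\int[lebesgue_measure]_(t in `[1%R, U]) (- F' t)%:E)%E = (F 1 - F U)%:E.
    under eq_integral do rewrite EFinN.
    rewrite integralN/=.
      by rewrite FTC -EFinB -EFinN opprB.
    apply: integrable_add_def => //; apply: continuous_compact_integrable => //.
    exact: segment_compact.
  by rewrite lee_fin F1 lerBrDr gerDl.
have upp : (\int[lebesgue_measure]_(t in `[1%R, U]) (- F' t)%:E <=
   \int[lebesgue_measure]_(t in `[1%R, U]) ((p^-1 * A `^ (1 - p))%:E * (H t)%:E))%E.
  (* [- F'] may change sign; its positive part obeys the same bound *)
  rewrite integralE; apply: (@le_trans _ _
    (\int[lebesgue_measure]_(t in `[1%R, U]) ((fun t => (- F' t)%:E)^\+ t))%E).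
    by rewrite -[leRHS]adde0 leeD2l// oppe_le0 integral_ge0.
  have mF' : measurable_fun `[1, U] (fun t => (- F' t)%:E).
    apply/measurable_EFinP; apply: measurableT_comp => //.
    by apply: subspace_continuous_measurable_fun.
  apply: ge0_le_integral => //.
  - exact: measurable_funepos.
  - apply: measurable_funTS; apply: measurable_funeM; exact/measurable_EFinP.
  move=> t tU; have t0 := pos t tU.
  rewrite funeposE -EFinM -EFin_max lee_fin ge_max.
  rewrite [X in _ && X]mulr_ge0 ?mulr_ge0 ?powR_ge0 ?invr_ge0 ?(ltW p0)// andbT.
  have B0 : 0 < A * t `^ (- s) by rewrite mulr_gt0// powR_gt0.
  have := powR_young p1 (normr_ge0 (h' t)) B0.
  rewrite powRM ?powR_ge0 ?(ltW A0)// -powRrM.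
  have -> : - s * (1 - p) = s * (p - 1) by ring.
  have eh : - (e * h' t) <= `|h' t|.
    rewrite (le_trans (ler_norm _))// normrN normrM /e normr_sg h1 mul1r//.
  rewrite /F' /H => Y; lra.
have := le_trans low upp.
rewrite ge0_integralZl//=; last 3 first.
- by apply: measurable_funTS; exact/measurable_EFinP.
- by move=> t _; rewrite lee_fin; exact: H0.
- by rewrite lee_fin mulr_ge0 ?powR_ge0 ?invr_ge0 ?ltW.
have -> : c `^ p * (s - 1) `^ (p - 1) = c * A `^ (p - 1).
  by rewrite powRM ?subr_ge0 ?ltW// mulrA mulr_powRB1// ltW.
move=> K; apply: (@le_trans _ _
  (\int[lebesgue_measure]_(t in `[1%R, U]) (H t)%:E)%E); last first.
  apply: ge0_subset_integral => //.
  - by apply: measurable_funTS; exact/measurable_EFinP.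
  - by move=> t _; rewrite lee_fin; exact: H0.
  - by apply: subset_itvl; rewrite bnd_simp.
have Z : 0 < p * A `^ (p - 1) by rewrite mulr_gt0// powR_gt0.
have := @lee_wpmul2l _ (p * A `^ (p - 1))%:E _ _ _ K.
rewrite lee_fin ltW// => /(_ isT).
rewrite muleA -!EFinM.
have -> : p * A `^ (p - 1) * (c * p^-1) = c * A `^ (p - 1).
  by field; rewrite gt_eqF.
have -> : p * A `^ (p - 1) * (p^-1 * A `^ (1 - p)) = 1.
  rewrite mulrACA mulfV ?gt_eqF// mul1r -powRD ?(gt_eqF A0) ?implybT//.
  by rewrite (_ : p - 1 + (1 - p) = 0) ?powRr0//; ring.
by rewrite mul1e.
Qed.

(** * The pointwise bound for test functions *)

Lemma powRN_cvgy0 (R : realType) (r : R) : 0 < r -> t `^ (- r) @[t --> +oo] --> (0 : R).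
Proof.
move=> r0; apply/cvgrPdist_le => e e0; near=> t.
have B0 : 0 < e `^ (- r^-1) by exact: powR_gt0.
rewrite sub0r normrN ger0_norm ?powR_ge0// powRN -[leRHS]invrK.
have tB : e `^ (- r^-1) <= t by near: t; exact: nbhs_pinfty_ge.
have t0 : 0 < t := lt_le_trans B0 tB.
rewrite lef_pV2 ?posrE ?invr_gt0// ?powR_gt0//.
rewrite -[leLHS]powR_inv1 ?(ltW e0)//.
have -> : e `^ (- 1) = (e `^ (- r^-1)) `^ r by rewrite -powRrM mulNr mulVf ?gt_eqF.
by rewrite ge0_ler_powR ?nnegrE// ltW.
Unshelve. all: by end_near. Qed.

Lemma integral_powRN (R : realType) (s : R) : 1 < s ->
  (\int[lebesgue_measure]_(t in `[1%R, +oo[) (t `^ (- s))%:E = ((s - 1)^-1)%:E)%E.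
Proof.
move=> s1; have s10 : 0 < s - 1 by rewrite subr_gt0.
pose F (t : R) := - (s - 1)^-1 * t `^ (- (s - 1)).
have dF (t : R) : 0 < t -> is_derive t (1 : R) F (t `^ (- s)).
  move=> t0; have dp := is_derive1_powR (- (s - 1)) t0.
  have -> : F = (- (s - 1)^-1) \*: (@powR R ^~ (- (s - 1))) by [].
  apply: is_derive_eq; rewrite /GRing.scale/= mulrA mulrNN mulVf ?gt_eqF// mul1r.
  by congr powR; ring.
have cF (t : R) : 0 < t -> {for t, continuous F}.
  move=> t0; apply: differentiable_continuous; apply/derivable1_diffP.
  by case: (dF t t0).
rewrite (@ge0_continuous_FTC2y R _ F 1 0).
- by rewrite /F powR1 mulr1 sub0e EFinN oppeK.
- by move=> t _; exact: powR_ge0.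
- apply: continuous_in_subspaceT => t /[!inE]/=; rewrite in_itv/= andbT => t1.
  apply: differentiable_continuous; apply/derivable1_diffP.
  by case: (is_derive1_powR (- s) (lt_le_trans ltr01 t1)).
- rewrite -[X in _ --> X](mulr0 (- (s - 1)^-1)).
  by apply: cvgM; [exact: cvg_cst|exact: powRN_cvgy0].
- by move=> t t1; case: (dF t (lt_trans ltr01 t1)).
- by apply: cvg_at_right_filter; exact: cF.
- move=> t; rewrite in_itv/= andbT => t1; rewrite derive1E.
  by have [_ ->] := dF t (lt_trans ltr01 t1).
Qed.

Section test_function.
Context (R : realType) (n : nat) (Omega : set 'rV[R]_n) (phi : 'rV[R]_n -> R).
Context (tphi : test_function Omega phi).

Lemma test_function_out x : ~ Omega x -> phi x = 0.
Proof.
case: tphi => _ _ sub nO; apply: contrapT => /eqP px; apply: nO; apply: sub.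
exact: subset_closure.
Qed.

Lemma gradient_test_function_out x : ~ Omega x -> gradient phi x = 0.
Proof.
case: tphi => _ _ sub nO; apply/rowP => i; rewrite !mxE /partial.
have : (~` closure [set x | phi x != 0]) x by move=> /sub.
have : open (~` closure [set x | phi x != 0]).
  by apply: closed_openC; exact: closed_closure.
rewrite openE => /[apply] nx.
have -> : 'D_(delta_mx ord0 i) phi x =
    'D_(delta_mx ord0 i) (cst 0 : 'rV[R]_n -> R) x.
  apply: near_eq_derive; apply: filterS nx => y ny /=.
  by apply: contrapT => /eqP py; apply: ny; exact: subset_closure.
exact: derive_cst.
Qed.

Lemma measurable_gradient_test_function :
  measurable_fun setT (gradient phi : 'rV[R]_n -> 'rV[R]_n).
Proof.
case: tphi => Ck _ _; have [_ C1] := Ck 1%N.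
apply: measurable_fun_rVP => i.
apply: (eq_measurable_fun (partial i phi)); first by move=> x _; rewrite mxE.
by apply: continuous_measurable_fun_rV; have [_ []] := C1 i.
Qed.

Lemma continuous_test_function : continuous phi.
Proof. by case: tphi => Ck _ _; have [] := Ck 0. Qed.

(** For [x != 0] this is [powR_le_integral_ray] for [h t = phi (t *: x)], with
    Cauchy-Schwarz for [h' t]; at the origin the quotient by
    [enorm 0 `^ p = 0] is [0] by convention. *)
Lemma hardy_pointwise (p s : R) (x : 'rV[R]_n) : bounded_set Omega ->
  1 < p -> 1 < s ->
  ((`|phi x| `^ p / enorm x `^ p * (s - 1) `^ (p - 1))%:E <=
   \int[lebesgue_measure]_(t in `[1%R, +oo[)
     (t `^ (s * (p - 1)) * enorm (gradient phi (t *: x)) `^ p)%:E)%E.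
Proof.
move=> bO p1 s1; have p0 : 0 < p := lt_trans ltr01 p1.
have [->|x0] := eqVneq x 0.
  have -> : enorm (0 : 'rV[R]_n) = 0 by apply/eqP; rewrite enorm_eq0.
  rewrite powR0 ?gt_eqF// invr0 mulr0 mul0r.
  by apply: integral_ge0 => t _; rewrite lee_fin mulr_ge0 ?powR_ge0.
have ex : 0 < enorm x by rewrite lt0r enorm_eq0 x0 enorm_ge0.
case: (tphi) => Ck _ _.
have [M [_ MO]] := bO.
have [T hT] : exists T : R, forall t, T <= t -> phi (t *: x) = 0.
  exists ((`|M| + 1) / `|x| + 1) => t tT; apply: test_function_out => Otx.
  have := MO (`|M| + 1); rewrite (le_lt_trans (ler_norm _))?ltrDl// => /(_ isT _ Otx).
  apply/negP; rewrite -ltNge normrZ.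
  have t0 : 0 < t by apply: lt_le_trans tT; rewrite ltr_wpDl// divr_ge0// addr_ge0.
  rewrite gtr0_norm// -ltr_pdivrMr ?normr_gt0//.
  by apply: lt_le_trans tT; rewrite ltrDl.
have mG := measurable_gradient_test_function.
pose h' (t : R) : R := dot x (gradient phi (t *: x)).
have ch' : continuous h'.
  move=> t; rewrite /h' /dot; apply: cvg_big => //; first exact: add_continuous.
  move=> i _; apply: cvgM; first exact: cvg_cst.
  under eq_cvg do rewrite mxE.
  have [_ C1] := Ck 1%N; have [_ [ci _]] := C1 i.
  rewrite mxE.
  apply: (@continuous_comp _ _ _ (fun u : R => u *: x) (partial i phi)).
    exact: scalel_continuous.
  exact: ci.
have := powR_le_integral_ray p1 s1 (fun t => is_derive_ray x t (Ck 1%N)) ch' hT.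
rewrite scale1r => H.
have mE : measurable_fun setT (fun t : measurableTypeR R =>
    t `^ (s * (p - 1)) * enorm (gradient phi (t *: x)) `^ p).
  apply: measurable_funM; first exact: measurable_powR.
  apply: (measurableT_comp (measurable_powR p)); apply: measurableT_comp => //.
    exact: measurable_enorm.
  apply: measurableT_comp => //; apply: measurable_fun_rVP => i.
  apply: (eq_measurable_fun (fun t : R => t * x ord0 i)).
    by move=> t _; rewrite mxE.
  exact: measurable_funM.
have {H} : ((`|phi x| `^ p * (s - 1) `^ (p - 1))%:E <=
   (enorm x `^ p)%:E * \int[lebesgue_measure]_(t in `[1%R, +oo[)
     (t `^ (s * (p - 1)) * enorm (gradient phi (t *: x)) `^ p)%:E)%E.
  apply: (le_trans H); rewrite -ge0_integralZl//=; last 3 first.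
  - by apply: measurable_funTS; exact/measurable_EFinP.
  - by move=> t _; rewrite lee_fin mulr_ge0 ?powR_ge0.
  - by rewrite lee_fin powR_ge0.
  apply: ge0_le_integral => //.
  - by move=> t _; rewrite lee_fin mulr_ge0 ?powR_ge0.
  - apply: measurable_funTS; apply/measurable_EFinP.
    apply: measurable_funM; first exact: measurable_powR.
    apply: (measurableT_comp (measurable_powR p)).
    by apply: measurableT_comp => //; exact: continuous_measurable_fun.
  - by apply: measurable_funTS; apply: measurable_funeM; exact/measurable_EFinP.
  move=> t _; rewrite -EFinM lee_fin mulrCA ler_wpM2l ?powR_ge0//.
  rewrite -powRM ?enorm_ge0// ge0_ler_powR ?nnegrE ?mulr_ge0 ?enorm_ge0//.
    exact: ltW.
  exact: ler_norm_dot.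
have Z : 0 <= (enorm x `^ p)^-1 by rewrite invr_ge0 powR_ge0.
move=> /(@lee_wpmul2l _ (enorm x `^ p)^-1%:E); rewrite lee_fin => /(_ Z).
rewrite muleA -!EFinM mulVf ?gt_eqF ?powR_gt0// mul1e.
by rewrite mulrA [_ * `|_| `^ _]mulrC.
Qed.

End test_function.

(** * The weighted Hardy inequality for test functions *)

(** After the substitution [y = t *: x], the bound on [w (l *: x)] is used with
    [l = t^-1]; the powers of [t] left by [hardy_pointwise] and by the Jacobian
    combine to [t `^ (- s)], where [s = n / p], which is integrable over
    [t >= 1]. *)
Lemma hardy_test_function (R : realType) n (Omega : set 'rV[R]_n)
    (phi w : 'rV[R]_n -> R) (p : R) :
  test_function Omega phi -> bounded_set Omega -> 1 < p -> p < n%:R ->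
  measurable_fun setT (w : 'rV[R]_n -> measurableTypeR R) ->
  (forall x, 0 <= w x) ->
  (forall (l : R) x, 0 < l <= 1 -> Omega x -> w (l *: x) <= w x) ->
  ((hardy_const n p)%:E *
     \int[borel_lebesgue_rV R n]_x (w x * (`|phi x| `^ p / enorm x `^ p))%:E <=
   \int[borel_lebesgue_rV R n]_x (w x * enorm (gradient phi x) `^ p)%:E)%E.
Proof.
move=> tphi bO p1 pn mw w0 wle; have p0 : 0 < p := lt_trans ltr01 p1.
pose s := n%:R / p; have s1 : 1 < s by rewrite ltr_pdivlMr// mul1r.
have s0 : 0 < s - 1 by rewrite subr_gt0.
pose mu := borel_lebesgue_rV R n.
pose G x := enorm (gradient phi x) `^ p.
have G0 x : 0 <= G x by exact: powR_ge0.
have mG : measurable_fun setT (G : 'rV[R]_n -> measurableTypeR R).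
  apply: (measurableT_comp (measurable_powR p)); apply: measurableT_comp.
    exact: measurable_enorm.
  exact: measurable_gradient_test_function tphi.
(* Tonelli's theorem is used on the whole line, hence the indicator *)
pose k (t : R) : R := \1_(`[1, +oo[%classic : set R) t * t `^ (s * (p - 1)).
have k0 t : 0 <= k t by rewrite mulr_ge0 ?powR_ge0.
have k_lt1 t : t < 1 -> k t = 0.
  by move=> t1; rewrite /k indicE memNset ?mul0r//= in_itv/= andbT leNgt t1.
have k_ge1 t : 1 <= t -> k t = t `^ (s * (p - 1)).
  by move=> t1; rewrite /k indicE mem_set ?mul1r//= in_itv/= andbT.
have mk : measurable_fun setT k.
  by apply: measurable_funM; [exact: measurable_indic|exact: measurable_powR].
have intk (f : R -> R) :
    (\int[lebesgue_measure]_(t in `[1%R, +oo[) (t `^ (s * (p - 1)) * f t)%:E =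
     \int[lebesgue_measure]_t (k t * f t)%:E)%E.
  rewrite integral_mkcond; apply: eq_integral => t _.
  by rewrite patchE /k indicE; case: ifP => _; rewrite ?mul1r ?mul0r.
pose Y := (\int[mu]_x (w x * G x)%:E)%E.
have Y0 : (0 <= Y)%E by apply: integral_ge0 => x _; rewrite lee_fin mulr_ge0.
pose Q x := `|phi x| `^ p / enorm x `^ p.
have Q0 x : 0 <= Q x by rewrite divr_ge0 ?powR_ge0.
pose c := (s - 1) `^ (p - 1).
have c0 : 0 < c by exact: powR_gt0.
have mQ : measurable_fun setT (Q : 'rV[R]_n -> measurableTypeR R).
  apply: measurable_funM.
    apply: (measurableT_comp (measurable_powR p)); apply: measurableT_comp => //.
    by apply: continuous_measurable_fun_rV; exact: continuous_test_function tphi.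
  apply: (eq_measurable_fun (fun x : 'rV[R]_n => enorm x `^ (- p))).
    by move=> x _; rewrite powRN.
  by apply: (measurableT_comp (measurable_powR _)); exact: measurable_enorm.
pose f (z : 'rV[R]_n * measurableTypeR R) : \bar R :=
  (w z.1 * (k z.2 * G (z.2 *: z.1)))%:E.
have f0 z : (0 <= f z)%E by rewrite lee_fin; apply: mulr_ge0 => //; exact: mulr_ge0.
have mscale : measurable_fun setT
    (fun z : 'rV[R]_n * measurableTypeR R => z.2 *: z.1).
  apply: measurable_fun_rVP => i.
  apply: (eq_measurable_fun
    (fun z : 'rV[R]_n * measurableTypeR R => z.2 * z.1 ord0 i)).
    by move=> z _; rewrite mxE.
  apply: measurable_funM; first exact: measurable_snd.
  exact: (measurableT_comp (@measurable_coord_rV R n i)).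
have mf : measurable_fun setT f.
  apply/measurable_EFinP; apply: measurable_funM.
    exact: (measurableT_comp mw).
  apply: measurable_funM; first exact: (measurableT_comp mk).
  exact: (measurableT_comp mG).
have step1 : (c%:E * \int[mu]_x (w x * Q x)%:E <=
    \int[mu]_x \int[lebesgue_measure]_t f (x, t))%E.
  rewrite -ge0_integralZl//=; last 3 first.
  - by apply/measurable_EFinP; exact: measurable_funM.
  - by move=> x _; rewrite lee_fin mulr_ge0.
  - by rewrite lee_fin ltW.
  apply: ge0_le_integral => //.
  - by move=> x _; apply: mule_ge0; rewrite lee_fin; [exact: ltW|exact: mulr_ge0].
  - by apply: measurable_funeM; apply/measurable_EFinP; exact: measurable_funM.
  - exact: measurable_fun_fubini_tonelli_F.
  move=> x _; rewrite /f /=.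
  have mx : measurable_fun setT (fun t : measurableTypeR R => k t * G (t *: x)).
    apply: measurable_funM; first exact: mk.
    apply: (measurableT_comp mG); apply: measurable_fun_rVP => i.
    apply: (eq_measurable_fun (fun t : measurableTypeR R => t * x ord0 i)).
      by move=> t _; rewrite mxE.
    exact: measurable_funM.
  under eq_integral do rewrite EFinM.
  rewrite ge0_integralZl//=; last 3 first.
  - exact/measurable_EFinP.
  - by move=> t _; rewrite lee_fin mulr_ge0.
  - by rewrite lee_fin.
  rewrite -intk -EFinM mulrCA EFinM lee_wpmul2l ?lee_fin//.
  by rewrite mulrC; exact: (hardy_pointwise tphi x bO p1 s1).
have step2 (t : R) : (\int[mu]_x f (x, t) <= (k t * t ^- n)%:E * Y)%E.
  rewrite /f /=; have [t1|t1] := leP 1 t; last first.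
    rewrite k_lt1// mul0r mul0e (eq_integral (cst 0%E)) ?integral0// => x _.
    by rewrite mul0r mulr0.
  have t0 : 0 < t := lt_le_trans ltr01 t1.
  (* the integrand in the variable [y = t *: x] *)
  pose g (y : 'rV[R]_n) : \bar R := (w (t^-1 *: y) * G y)%:E.
  have mg : measurable_fun setT g.
    apply/measurable_EFinP; apply: measurable_funM => //.
    by apply: (measurableT_comp mw); exact: measurable_scale_rV.
  have g0 y : (0 <= g y)%E by rewrite lee_fin mulr_ge0.
  rewrite (eq_integral (fun x => (k t)%:E * (g \o (fun x => t *: x)%R) x)%E); last first.
    by move=> x _; rewrite /g /= scalerA mulVf ?gt_eqF// scale1r mulrCA EFinM.
  have mgt : measurable_fun setT (g \o (fun x : 'rV[R]_n => t *: x)).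
    by apply: (measurableT_comp mg); exact: measurable_scale_rV.
  rewrite (ge0_integralZl mu measurableT mgt); last 2 first.
  - by move=> x _; exact: g0.
  - by rewrite lee_fin k0.
  rewrite (_ : (k t * t ^- n)%:E * Y = (k t)%:E * ((t ^- n)%:E * Y))%E; last first.
    by rewrite EFinM muleA.
  apply: lee_wpmul2l; first by rewrite lee_fin k0.
  rewrite (ge0_integral_rV_scale t0 mg g0).
  rewrite lee_wpmul2l ?lee_fin ?invr_ge0 ?exprn_ge0 ?(ltW t0)//.
  apply: ge0_le_integral.
  - exact: measurableT.
  - by move=> y _; exact: g0.
  - exact: mg.
  - by apply/measurable_EFinP; exact: measurable_funM.
  move=> y _; rewrite lee_fin.
  have [Oy|nOy] := pselect (Omega y).
    by rewrite ler_wpM2r// wle// invr_gt0 t0 invf_le1.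
  rewrite /G (gradient_test_function_out tphi nOy).
  have -> : enorm (0 : 'rV[R]_n) = 0 by apply/eqP; rewrite enorm_eq0.
  by rewrite powR0 ?gt_eqF// !mulr0.
have step3 : (\int[lebesgue_measure]_t \int[mu]_x f (x, t) <= (s - 1)^-1%:E * Y)%E.
  rewrite -(integral_powRN s1) -ge0_integralZr//=; last 2 first.
  - by apply: measurable_funTS; apply/measurable_EFinP; exact: measurable_powR.
  - by move=> t _; rewrite lee_fin powR_ge0.
  rewrite [leRHS]integral_mkcond.
  have E (t : R) : ((k t * t ^- n)%:E * Y =
      ((fun t : R => (t `^ (- s))%:E * Y) \_ `[1%R, +oo[) t)%E.
    rewrite patchE; have [t1|t1] := leP 1 t; last first.
      by rewrite k_lt1// mul0r mul0e memNset//= in_itv/= andbT leNgt t1.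
    rewrite mem_set/= ?in_itv/= ?andbT// k_ge1//.
    have t0 : 0 < t := lt_le_trans ltr01 t1.
    congr (_%:E * _)%E; rewrite -powR_invn ?(ltW t0)// -powRD ?(gt_eqF t0) ?implybT//.
    have -> // : s * (p - 1) - n%:R = - s.
      by rewrite /s; field; rewrite gt_eqF.
  under [leRHS]eq_integral do rewrite -E.
  apply: ge0_le_integral.
  - exact: measurableT.
  - by move=> t _; exact: integral_ge0.
  - exact: measurable_fun_fubini_tonelli_G.
  - apply: emeasurable_funM; last exact: measurable_cst.
    apply/measurable_EFinP.
    apply: (eq_measurable_fun (fun t : R => k t * t `^ (- n%:R))).
      move=> t _; have [t1|t1] := leP 1 t; last by rewrite k_lt1// !mul0r.
      by rewrite powR_invn// (le_trans ler01).
    by apply: measurable_funM; [exact: mk|exact: measurable_powR].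
  - by move=> t _; exact: step2.
have := le_trans step1; rewrite (fubini_tonelli f)// => /(_ _ step3) H.
have -> : hardy_const n p = (s - 1) * c.
  rewrite /c mulr_powRB1// ?(ltW s0)// /hardy_const.
  have -> : s - 1 = (p / (n%:R - p)) `^ (- 1).
    rewrite powR_inv1 ?invf_div; last by apply: divr_ge0; rewrite ?subr_ge0; exact: ltW.
    by rewrite /s mulrBl divff ?gt_eqF.
  by rewrite -powRrM mulN1r.
rewrite EFinM -muleA.
have := @lee_wpmul2l _ (s - 1)%:E _ _ _ H.
rewrite lee_fin (ltW s0) => /(_ isT) /le_trans; apply.
by rewrite muleA -EFinM mulfV ?gt_eqF// mul1e.
Qed.

(** * Passage to the limit *)

(** Convexity of [_ `^ p] at [x + y = th * (x / th) + (1 - th) * (y / (1 - th))];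
    the factor of [x `^ p] tends to [1] as [th] does. *)
Lemma powRD_le_convex (R : realType) (p th x y : R) :
  1 <= p -> 0 < th < 1 -> 0 <= x -> 0 <= y ->
  (x + y) `^ p <= th `^ (1 - p) * x `^ p + (1 - th) `^ (1 - p) * y `^ p.
Proof.
move=> p1 /andP[th0 th1] x0 y0.
have h0 : 0 < 1 - th by rewrite subr_gt0.
have := @convex_powR R p p1 (Itv01 (ltW th0) (ltW th1)) (x / th) (y / (1 - th)).
rewrite !inE/= !in_itv/= !andbT !divr_ge0 ?(ltW th0) ?(ltW h0)// => /(_ isT isT).
rewrite [X in _ <= X]convRE/= /unstable.onem.
have E (t z : R) : 0 < t -> 0 <= z -> t * (z / t) `^ p = t `^ (1 - p) * z `^ p.
  move=> t0 z0; rewrite powRM ?invr_ge0 ?(ltW t0)// mulrCA [RHS]mulrC; congr (_ * _).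
  rewrite -[t^-1]powR_inv1 ?(ltW t0)// -powRrM mulN1r.
  by rewrite powRD ?(gt_eqF t0) ?implybT// powRr1 ?(ltW t0).
rewrite !E//.
have F (t z : R) : 0 < t -> t * (z / t) = z.
  by move=> t0; rewrite mulrCA mulfV ?mulr1 ?gt_eqF.
apply: le_trans.
rewrite -[X in (X + _) `^ _](F th)// -[X in (_ + X) `^ _](F (1 - th))//; exact: lexx.
Qed.

(** The chain of estimates in [le_integral_powR_limit], where the atoms stand
    for integrals. *)
Lemma perturbed_le (R : realType) (C r1 r2 M delta : R)
    (NU NU' NVU' Ne NMe NG NG' Nr : \bar R) :
  0 <= C -> 0 <= r1 -> 0 <= r2 -> 0 <= M ->
  (0 <= NU')%E -> (0 <= NMe)%E -> (0 <= NG)%E ->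
  (NU <= r1%:E * NU' + r2%:E * NMe)%E -> (NU' <= NVU')%E ->
  (C%:E * NVU' <= NG')%E -> (NG' <= r1%:E * NG + r2%:E * Nr)%E ->
  (NMe <= M%:E * Ne)%E -> (Ne <= delta%:E)%E -> (Nr <= delta%:E)%E ->
  (C%:E * NU <= (r1 * r1)%:E * NG +
    (r1 * (r2 * delta) + r2 * (C * (M * delta)))%:E)%E.
Proof.
move=> C0 r10 r20 M0 NU'0 NMe0 NG0 HU HV HC HG HM He Hr.
have pos (r : R) (X Y : \bar R) : 0 <= r -> (X <= Y)%E -> (r%:E * X <= r%:E * Y)%E.
  by move=> r0 XY; apply: lee_wpmul2l; rewrite ?lee_fin.
have pos0 (r : R) (X : \bar R) : 0 <= r -> (0 <= X)%E -> (0 <= r%:E * X)%E.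
  by move=> r0 X0; apply: mule_ge0; rewrite ?lee_fin.
have B1 : (C%:E * NU' <= r1%:E * NG + (r2 * delta)%:E)%E.
  apply: (le_trans (pos _ _ _ C0 HV)); apply: (le_trans HC); apply: (le_trans HG).
  by rewrite EFinM; apply: leeD2l; exact: pos.
have B2 : (NMe <= (M * delta)%:E)%E.
  by apply: (le_trans HM); rewrite EFinM; exact: pos.
apply: (le_trans (pos _ _ _ C0 HU)); rewrite ge0_muleDr ?pos0//.
rewrite muleCA [X in (_ + X)%E]muleCA.
apply: (@le_trans _ _ (r1%:E * (r1%:E * NG + (r2 * delta)%:E) +
    r2%:E * (C%:E * (M * delta)%:E))%E).
  by apply: leeD; [exact: pos|apply: (pos _ _ _ r20); exact: pos].
rewrite muleDr ?fin_num_adde_defl//.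
by rewrite muleA -!EFinM -addeA -EFinD.
Qed.

Section weighted.
Context d (T : measurableType d) (R : realType) (mu : {measure set T -> \bar R}).
Variables (D : set T) (mD : measurable D) (w : T -> R) (p : R).
Hypotheses (mw : measurable_fun D w) (w0 : forall x, 0 <= w x) (p1 : 1 < p).

Let p0 : 0 <= p. Proof. exact: (le_trans ler01 (ltW p1)). Qed.

Local Notation N v f := (\int[mu]_(x in D) (v x * f x `^ p)%:E)%E.

Let mN (v f : T -> R) : measurable_fun D v -> measurable_fun D f ->
  measurable_fun D (fun x => (v x * f x `^ p)%:E).
Proof.
move=> mv mf; apply/measurable_EFinP; apply: measurable_funM => //.
exact: (measurableT_comp (measurable_powR p)).
Qed.

Lemma integral_powRD_le (v f g h : T -> R) (th : R) :
  0 < th < 1 -> measurable_fun D v -> (forall x, 0 <= v x) ->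
  measurable_fun D f -> measurable_fun D g -> measurable_fun D h ->
  (forall x, 0 <= f x) -> (forall x, 0 <= g x) -> (forall x, 0 <= h x) ->
  (forall x, D x -> h x <= f x + g x) ->
  (N v h <= (th `^ (1 - p))%:E * N v f + ((1 - th) `^ (1 - p))%:E * N v g)%E.
Proof.
move=> th01 mv v0 mf mg mh f0 g0 h0 hfg.
have pos (u : T -> R) x : 0 <= v x * u x `^ p by rewrite mulr_ge0 ?powR_ge0.
rewrite -!ge0_integralZl//=;
  try by [exact: mN|move=> x _; rewrite lee_fin|rewrite lee_fin powR_ge0].
have posZ (u : T -> R) (r : R) x : (0 <= (r `^ (1 - p))%:E * (v x * u x `^ p)%:E)%E.
  by rewrite mule_ge0 ?lee_fin ?powR_ge0.
rewrite -ge0_integralD//=; try by [apply: measurable_funeM; exact: mN].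
apply: ge0_le_integral => //.
- by move=> x _; rewrite lee_fin.
- exact: mN.
- by apply: emeasurable_funD; apply: measurable_funeM; exact: mN.
move=> x Dx; rewrite -!EFinM -EFinD lee_fin mulrCA [X in _ + X]mulrCA -mulrDr.
apply: ler_wpM2l => //.
apply: le_trans (powRD_le_convex (ltW p1) th01 (f0 x) (g0 x)).
by rewrite ge0_ler_powR ?nnegrE ?addr_ge0// hfg.
Qed.

(** While the singular weight [V] is truncated, the norm with weight [w]
    controls the approximation errors of both [U] and [G]; the truncation is
    removed last.  In the application [U'] and [G'] come from a test function,
    and [e] and [r] are the moduli of the differences. *)
Lemma le_integral_powR_limit (V U G : T -> R) (C : R) :
  0 <= C -> measurable_fun D V -> (forall x, 0 <= V x) ->
  measurable_fun D U -> (forall x, 0 <= U x) ->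
  measurable_fun D G -> (forall x, 0 <= G x) ->
  (forall eps : R, 0 < eps -> exists U' e G' r : T -> R,
    [/\ [/\ measurable_fun D U', measurable_fun D e,
            measurable_fun D G' & measurable_fun D r],
        [/\ forall x, 0 <= U' x, forall x, 0 <= e x,
            forall x, 0 <= G' x & forall x, 0 <= r x],
        [/\ forall x, D x -> U x <= U' x + e x & forall x, D x -> G' x <= G x + r x],
        (C%:E * N (fun x => w x * V x)%R U' <= N w G')%E &
        [/\ N w e <= eps%:E & N w r <= eps%:E]%E]) ->
  (C%:E * N (fun x => w x * V x)%R U <= N w G)%E.
Proof.
move=> C0 mV V0 mU U0 mG G0 H.
have NG0 : (0 <= N w G)%E.
  by apply: integral_ge0 => x _; rewrite lee_fin mulr_ge0 ?powR_ge0.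
pose VM (M : R) x := w x * Num.min (V x) M.
have mVM (M : R) : measurable_fun D (VM M).
  apply: measurable_funM => //; apply: measurable_minr => //; exact: measurable_cst.
have VM0 (M : R) x : 0 <= M -> 0 <= VM M x.
  by move=> M0; rewrite mulr_ge0// le_min V0.
(* [th] close to [1] makes the constant close to [1] *)
have trunc (M th : R) : 0 <= M -> 0 < th < 1 ->
    (C%:E * N (VM M) U <= (th `^ (1 - p) * th `^ (1 - p))%:E * N w G)%E.
  move=> M0 th01; set r1 := th `^ (1 - p); set r2 := (1 - th) `^ (1 - p).
  have r10 : 0 <= r1 by exact: powR_ge0.
  have r20 : 0 <= r2 by exact: powR_ge0.
  apply/lee_addgt0Pr => eps eps0.
  (* [K - 1] is the total factor of the two errors *)
  pose K := C * (r2 * M) + r1 * r2 + 1.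
  have K0 : 0 < K by rewrite ltr_wpDl// addr_ge0 ?mulr_ge0.
  have [U' [e [G' [r [[mU' me mG' mr] [U'0 e0 G'0 r0] [UU GG] HC [He Hr]]]]]] :=
    H (eps / K) (divr_gt0 eps0 K0).
  have A1 : (N (VM M) U <= r1%:E * N (VM M) U' + r2%:E * N (VM M) e)%E.
    by apply: integral_powRD_le => // x; exact: VM0.
  have A2 : (N w G' <= r1%:E * N w G + r2%:E * N w r)%E.
    exact: integral_powRD_le.
  have A3 : (N (VM M) U' <= N (fun x => w x * V x)%R U')%E.
    apply: ge0_le_integral => //.
    - by move=> x _; rewrite lee_fin mulr_ge0 ?powR_ge0// VM0.
    - exact: mN.
    - by apply: mN => //; exact: measurable_funM.
    by move=> x _; rewrite lee_fin ler_wpM2r ?powR_ge0// ler_wpM2l// ge_min lexx.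
  have A4 : (N (VM M) e <= M%:E * N w e)%E.
    rewrite -ge0_integralZl//=; last 2 first.
    - exact: mN.
    - by move=> x _; rewrite lee_fin mulr_ge0 ?powR_ge0.
    apply: ge0_le_integral => //.
    - by move=> x _; rewrite lee_fin mulr_ge0 ?powR_ge0// VM0.
    - exact: mN.
    - by apply: measurable_funeM; exact: mN.
    move=> x _; rewrite -EFinM lee_fin mulrA ler_wpM2r ?powR_ge0//.
    by rewrite [leRHS]mulrC ler_wpM2l// ge_min lexx orbT.
  have N0 (v f : T -> R) : (forall x, 0 <= v x) -> (0 <= N v f)%E.
    by move=> v0; apply: integral_ge0 => x _; rewrite lee_fin mulr_ge0 ?powR_ge0.
  apply: (le_trans (perturbed_le C0 r10 r20 M0 (N0 _ _ _) (N0 _ _ _) (N0 _ _ _)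
    A1 A3 HC A2 A4 He Hr)).
  - by move=> x; exact: VM0.
  - by move=> x; exact: VM0.
  - exact: w0.
  apply: leeD2l; rewrite lee_fin.
  have -> : r1 * (r2 * (eps / K)) + r2 * (C * (M * (eps / K))) = (K - 1) / K * eps.
    by rewrite /K; field; rewrite -/K gt_eqF.
  by rewrite ler_piMl ?(ltW eps0)// ler_pdivrMr// mul1r gerBl.
have full (M : R) : 0 <= M -> (C%:E * N (VM M) U <= N w G)%E.
  move=> M0.
  move: NG0 (trunc M); move: (N w G) (N (VM M) U) => NwG NMU.
  case: NwG => [y|_ _|]; [|exact: leey|by rewrite leeNy_eq].
  rewrite lee_fin => y0 tr.
  apply/lee_addgt0Pr => eps eps0.
  pose rho : R := 1 + eps / (y + 1).
  have rho1 : 1 < rho by rewrite ltrDl divr_gt0// ltr_wpDl.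
  have rho0 : 0 < rho := lt_trans ltr01 rho1.
  have q0 : 0 < p - 1 by rewrite subr_gt0.
  (* chosen so that [th `^ (1 - p)] is the square root of [rho] *)
  pose th := rho `^ (- (2 * (p - 1))^-1).
  have th01 : 0 < th < 1.
    rewrite powR_gt0//= /th powRN invf_lt1 ?powR_gt0//.
    have k0 : 0 < (2 * (p - 1))^-1 by rewrite invr_gt0 mulr_gt0.
    have := gt0_ltr_powR k0 (x := 1) (y := rho).
    by rewrite !nnegrE ler01 powR1 (ltW rho0); apply.
  have := tr th M0 th01.
  have -> : th `^ (1 - p) * th `^ (1 - p) = rho.
    have thn : th != 0 by case/andP: th01 => t0 _; rewrite gt_eqF.
    rewrite -powRD ?thn ?implybT//.
    rewrite -powRrM (_ : _ * _ = 1) ?powRr1 ?(ltW rho0)//.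
    by field; rewrite ?gt_eqF.
  move=> /le_trans; apply; rewrite -EFinM -EFinD lee_fin /rho mulrDl mul1r lerD2l.
  by rewrite mulrAC ler_pdivrMr ?ltr_wpDl// ler_wpM2l ?(ltW eps0)// lerDl.
(* monotone convergence removes the truncation *)
have wVE x : D x -> (w x * V x * U x `^ p)%:E =
    limn (fun n => (VM n%:R x * U x `^ p)%:E).
  move=> _; apply/esym/cvg_lim => //.
  apply: cvg_near_cst; near=> n.
  rewrite /VM (_ : Num.min _ _ = V x)//; apply/min_idPl.
  near: n; exact: nbhs_infty_ger.
have cv : N (VM n%:R) U @[n --> \oo] --> N (fun x => w x * V x)%R U.
  have -> : N (fun x => w x * V x)%R U =
      (\int[mu]_(x in D) limn (fun n => (VM n%:R x * U x `^ p)%:E))%E.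
    by apply: eq_integral => x /[!inE]; exact: wVE.
  apply: cvg_monotone_convergence => //.
  - by move=> n; exact: mN.
  - by move=> n x _; rewrite lee_fin mulr_ge0 ?powR_ge0 ?VM0.
  - move=> x _ m n mn; rewrite lee_fin ler_wpM2r ?powR_ge0// ler_wpM2l//.
    by rewrite le_min ge_min lexx /= ge_min ler_nat mn orbT.
have cC : (C%:E * N (VM n%:R) U)%E @[n --> \oo] -->
    (C%:E * N (fun x => w x * V x)%R U)%E.
  exact: cvgeZl.
rewrite -(cvg_lim _ cC)//; apply: lime_le; first by apply/cvg_ex; eexists; exact: cC.
by apply: nearW => n; exact: full.
Unshelve. all: by end_near. Qed.

End weighted.

(** * From test functions to the Sobolev space *)

Lemma lipschitz_continuous_interior (R : realType) n (A B : set 'rV[R]_n)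
    (f : 'rV[R]_n -> R) :
  open B -> B `<=` A -> [lipschitz f x | x in A] -> {in B, continuous f}.
Proof.
move=> oB BA /pinfty_ex_gt0[M M0 fM] x /[!inE] Bx.
apply/(@cvgrPdist_lt _ _ _ (nbhs x)) => e e0.
have Bnx : nbhs x B by move: oB; rewrite openE; exact.
near=> y; have By : B y by near: y.
have := fM (x, y) (conj (BA _ Bx) (BA _ By)); rewrite /self_sub/= => /le_lt_trans; apply.
rewrite mulrC -ltr_pdivlMr//; near: y.
by apply: cvgr_dist_lt; [exact: cvg_id|exact: divr_gt0].
Unshelve. all: by end_near. Qed.

Lemma enormN (R : realType) n (x : 'rV[R]_n) : enorm (- x) = enorm x.
Proof.
rewrite /enorm; congr Num.sqrt.
by apply: eq_bigr => i _; rewrite !mxE mulrNN.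
Qed.

Lemma luxemburg_ge0 (R : realType) n (Omega : set 'rV[R]_n) (p q : R) a f :
  (0 <= luxemburg Omega p q a f)%E.
Proof. by apply: le_ereal_inf_tmp => _ [l [l0 _] <-]; rewrite lee_fin ltW. Qed.

(** Homogeneity: [f = k * (f / k)] with [k < l <= 1] and [1 <= m], so the
    integral of [v * |f| `^ m] gains the factor [k `^ m <= k] over the one of
    [v * |f / k| `^ m]. *)
Lemma integral_powR_le_modular d (T : measurableType d) (R : realType)
    (mu : {measure set T -> \bar R}) (D : set T) (dp : T -> R -> R)
    (v f : T -> R) (k l m : R) :
  measurable D -> measurable_fun D v -> measurable_fun D f ->
  measurable_fun D (fun x => dp x `|f x / k|) ->
  1 <= m -> 0 < k -> k < l -> l <= 1 ->
  (forall x t, D x -> 0 <= v x * t `^ m <= dp x t) ->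
  (\int[mu]_(x in D) (dp x `|f x / k|%R)%:E <= 1)%E ->
  (\int[mu]_(x in D) (v x * `|f x| `^ m)%:E <= l%:E)%E.
Proof.
move=> mD mv mf mdp m1 k0 kl l1 vdp Hk.
apply: (@le_trans _ _ (k%:E * \int[mu]_(x in D) (dp x `|f x / k|%R)%:E)%E).
  have dp0 x t : D x -> 0 <= dp x t.
    by move=> Dx; have /andP[v0 vle] := vdp x t Dx; exact: le_trans vle.
  rewrite -ge0_integralZl//=; last 3 first.
  - exact/measurable_EFinP.
  - by move=> x Dx; rewrite lee_fin dp0.
  - by rewrite lee_fin ltW.
  apply: ge0_le_integral => //.
  - by move=> x Dx; rewrite lee_fin; have /andP[] := vdp x `|f x| Dx.
  - apply/measurable_EFinP; apply: measurable_funM => //.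
    by apply: (measurableT_comp (measurable_powR m)); exact: measurableT_comp.
  - by apply: measurable_funeM; exact/measurable_EFinP.
  move=> x Dx; rewrite -EFinM lee_fin.
  have /andP[v0 vle] := vdp x `|f x / k| Dx.
  apply: le_trans (ler_wpM2l (ltW k0) vle).
  rewrite [in leLHS](_ : `|f x| = k * `|f x / k|); last first.
    by rewrite normrM normfV (gtr0_norm k0) mulrCA mulfV ?mulr1// gt_eqF.
  rewrite powRM ?(ltW k0)// mulrCA ler_wpM2r//.
  by rewrite ge1r_powR// k0 (le_trans (ltW kl)).
apply: (@le_trans _ _ (k%:E * 1)%E); first by rewrite lee_wpmul2l// lee_fin ltW.
by rewrite mule1 lee_fin ltW.
Qed.

Lemma measurable_fun_modular d (T : measurableType d) (R : realType)
    (D : set T) (a f : T -> R) (p q k : R) :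
  measurable_fun D a -> measurable_fun D f ->
  measurable_fun D (fun x => `|f x / k| `^ p + a x * `|f x / k| `^ q).
Proof.
move=> ma mf.
have mfk : measurable_fun D (fun x => `|f x / k|).
  by apply: measurableT_comp => //; exact: measurable_funM.
apply: measurable_funD; first exact: (measurableT_comp (measurable_powR p)).
by apply: measurable_funM => //; exact: (measurableT_comp (measurable_powR q)).
Qed.

Lemma measurable_fun_normr d (T : measurableType d) (R : realType)
    (D : set T) (f : T -> R) :
  measurable_fun D f -> measurable_fun D (fun x => `|f x|).
Proof. by move=> mf; exact: measurableT_comp. Qed.

(** The Luxemburg norm controls each part of the double phase density
    separately; the weights [v] of interest are [1] and [a]. *)
Lemma luxemburg_lt (R : realType) n (Omega : set 'rV[R]_n) (p q m : R)
    (a v f : 'rV[R]_n -> R) (l : R) :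
  measurable (Omega : set (lebesgue_rV_type R n)) ->
  measurable_fun (Omega : set (lebesgue_rV_type R n))
    (a : lebesgue_rV_type R n -> R) ->
  measurable_fun (Omega : set (lebesgue_rV_type R n))
    (v : lebesgue_rV_type R n -> R) ->
  measurable_fun (Omega : set (lebesgue_rV_type R n))
    (f : lebesgue_rV_type R n -> R) ->
  1 <= m -> l <= 1 ->
  (forall x t, Omega x -> 0 <= v x * t `^ m <= double_phase p q a x t) ->
  (luxemburg Omega p q a f < l%:E)%E ->
  (\int[lebesgue_rV R n]_(x in Omega) (v x * `|f x| `^ m)%:E <= l%:E)%E.
Proof.
move=> mO ma mv mf m1 l1 vdp /ereal_inf_lt[_ [k [k0 Hk] <-]].
rewrite lte_fin => kl.
exact: (integral_powR_le_modular mO mv mf (measurable_fun_modular p q k ma mf)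
  m1 k0 kl l1 vdp Hk).
Qed.

(** The two inequalities of the theorem differ only in the part
    [w x * t `^ m] of the double phase density that is retained. *)
Lemma hardy_W1H0 (R : realType) N (Omega : set 'rV[R]_N) (p q m : R)
    (a w : 'rV[R]_N -> R) (u : 'rV[R]_N -> R) (g : 'rV[R]_N -> 'rV[R]_N) :
  open Omega -> bounded_set Omega -> 1 < m -> m < N%:R ->
  measurable_fun Omega (a : 'rV[R]_N -> measurableTypeR R) ->
  measurable_fun setT (w : 'rV[R]_N -> measurableTypeR R) ->
  (forall x, 0 <= w x) ->
  (forall (l : R) x, 0 < l <= 1 -> Omega x -> w (l *: x) <= w x) ->
  (forall x t, Omega x -> 0 <= w x * t `^ m <= double_phase p q a x t) ->
  W1H0 Omega p q a u g ->
  ((hardy_const N m)%:E *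
      \int[lebesgue_rV R N]_(x in Omega) (w x * (`|u x| `^ m / enorm x `^ m))%:E
    <= \int[lebesgue_rV R N]_(x in Omega) (w x * enorm (g x) `^ m)%:E)%E.
Proof.
move=> oO bO m1 mN ma mw w0 wle wdp [[[mu _] [_ mg _] [meg _]] [phi [tphi cphi]]].
pose E := lebesgue_rV_type R N.
have bmO := open_measurable_rV oO.
have mO : measurable (Omega : set E) := measurable_lebesgue_rV bmO.
have toO (f : 'rV[R]_N -> R) :
    measurable_fun setT (f : 'rV[R]_N -> measurableTypeR R) ->
    measurable_fun (Omega : set E) (f : E -> R).
  by move=> mf; apply: (measurable_fun_lebesgue_rV bmO); exact: measurable_funTS.
have maE : measurable_fun (Omega : set E) (a : E -> R).
  exact: (measurable_fun_lebesgue_rV bmO ma).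
pose V (x : 'rV[R]_N) : R := (enorm x `^ m)^-1.
have mV : measurable_fun setT (V : 'rV[R]_N -> measurableTypeR R).
  apply: (eq_measurable_fun (fun x : 'rV[R]_N => enorm x `^ (- m))).
    by move=> x _; rewrite /V powRN.
  by apply: (measurableT_comp (measurable_powR _)); exact: measurable_enorm.
have V0 x : 0 <= V x by rewrite invr_ge0 powR_ge0.
have wVE (f : 'rV[R]_N -> R) :
   (\int[lebesgue_rV R N]_(x in Omega) (w x * (f x / enorm x `^ m))%:E =
    \int[lebesgue_rV R N]_(x in Omega) (w x * V x * f x)%:E)%E.
  by apply: eq_integral => x _; rewrite mulrA mulrAC.
have mphi k : measurable_fun setT (phi k : 'rV[R]_N -> measurableTypeR R).
  by apply: continuous_measurable_fun_rV; exact: continuous_test_function (tphi k).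
have mgphi k := measurable_gradient_test_function (tphi k).
have megphi k : measurable_fun setT
    ((fun x => enorm (gradient (phi k) x)) : 'rV[R]_N -> measurableTypeR R).
  exact: measurableT_comp (@measurable_enorm R N) (mgphi k).
rewrite wVE.
apply: (@le_integral_powR_limit _ E R (lebesgue_rV R N) Omega mO w m (toO _ mw)
   w0 m1 V (fun x => `|u x|) (fun x => enorm (g x)) (hardy_const N m)
   (powR_ge0 _ _) (toO _ mV) V0 (measurable_fun_normr mu) (fun x => normr_ge0 (u x))
   meg (fun x => enorm_ge0 (g x))).
move=> eps eps0.
pose l := Num.min eps 1.
have l0 : 0 < l by rewrite lt_min eps0 ltr01.
have [k _ /(_ k (leqnn k)) kl] : \forall k \near \oo,
    (W1H_norm Omega p q a (fun x => u x - phi k x)%R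
       (fun x => g x - gradient (phi k) x)%R < l%:E)%E.
  apply: (cphi [set y | (y < l%:E)%E]).
  by apply: (@open_ereal_lt' _ 0%E); rewrite lte_fin.
have mer : measurable_fun (Omega : set E)
    ((fun x => enorm (g x - gradient (phi k) x)) : E -> R).
  apply: measurable_fun_enorm => i.
  apply: (eq_measurable_fun (fun x : E => g x ord0 i - gradient (phi k) x ord0 i)).
    by move=> x _; rewrite !mxE.
  have [mgi _] := mg i.
  apply: (measurable_funB mgi (toO (fun x => gradient (phi k) x ord0 i) _)).
  exact: (measurableT_comp (@measurable_coord_rV R N i)).
have mup := measurable_funB mu (toO _ (mphi k)).
exists (fun x => `|phi k x|), (fun x => `|u x - phi k x|),
  (fun x => enorm (gradient (phi k) x)),
  (fun x => `|enorm (g x - gradient (phi k) x)|).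
split.
- split.
  + exact: (measurable_fun_normr (toO _ (mphi k))).
  + exact: (measurable_fun_normr mup).
  + exact: (toO _ (megphi k)).
  + exact: (measurable_fun_normr mer).
- by split => x; rewrite ?enorm_ge0.
- split => x Ox.
    by rewrite -{1}[u x](subrK (phi k x)) addrC ler_normD.
  rewrite ger0_norm ?enorm_ge0// [leRHS]addrC -[enorm (g x - _)]enormN opprB.
  by rewrite -{1}[gradient _ _](subrK (g x)) ler_enormD.
- have intT (f : 'rV[R]_N -> R) :
      measurable_fun setT (f : 'rV[R]_N -> measurableTypeR R) ->
      (forall x, 0 <= f x) -> (forall x, ~ Omega x -> f x = 0) ->
      (\int[lebesgue_rV R N]_(x in Omega) (f x)%:E =
       \int[borel_lebesgue_rV R N]_x (f x)%:E)%E.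
    move=> mf f0 fO; rewrite integral_lebesgue_rV//.
    + rewrite integral_mkcond; apply: eq_integral => x _; rewrite patchE.
      by case: ifPn => //; rewrite notin_setE => /fO ->.
    + by apply: measurable_funTS; exact/measurable_EFinP.
    + by move=> x _; rewrite lee_fin.
  have m0 : 0 `^ m = 0 :> R by rewrite powR0// gt_eqF// (lt_trans ltr01).
  have mhardy : measurable_fun setT ((fun x => w x *
      (`|phi k x| `^ m / enorm x `^ m)) : 'rV[R]_N -> measurableTypeR R).
    have mphim := measurableT_comp (measurable_powR m)
      (measurable_fun_normr (mphi k)).
    exact: measurable_funM mw (measurable_funM mphim mV).
  have mdir : measurable_fun setT ((fun x => w x *
      enorm (gradient (phi k) x) `^ m) : 'rV[R]_N -> measurableTypeR R).
    exact: measurable_funM mw (measurableT_comp (measurable_powR m) (megphi k)).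
  (* [phi k] and its gradient vanish outside [Omega] *)
  rewrite -wVE (intT _ mhardy) ?(intT _ mdir).
  + exact: (hardy_test_function (tphi k) bO m1 mN mw w0 wle).
  + by move=> x; rewrite mulr_ge0 ?powR_ge0.
  + move=> x nO; rewrite (gradient_test_function_out (tphi k) nO).
    by rewrite (_ : enorm 0 = 0) ?m0 ?mulr0//; apply/eqP; rewrite enorm_eq0.
  + by move=> x; rewrite mulr_ge0 ?divr_ge0 ?powR_ge0.
  + move=> x nO; rewrite (test_function_out (tphi k) nO).
    by rewrite normr0 m0 mul0r mulr0.
have l1 : l <= 1 by rewrite ge_min lexx orbT.
have le : (l%:E <= eps%:E)%E by rewrite lee_fin ge_min lexx.
have lux (f : 'rV[R]_N -> R) := @luxemburg_lt _ _ _ p q m a w f l mO maE (toO _ mw).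
split; apply: le_trans le.
- apply: (lux _ mup (ltW m1) l1 wdp).
  by apply: le_lt_trans kl; rewrite /W1H_norm leeDl// luxemburg_ge0.
- apply: (lux _ mer (ltW m1) l1 wdp).
  by apply: le_lt_trans kl; rewrite /W1H_norm leeDr// luxemburg_ge0.
Qed.

Theorem lemma2p1 (R : realType) (N : nat) (Omega : set 'rV[R]_N) (p q : R)
    (a : 'rV[R]_N -> R)
    (N_ge2 : (2 <= N)%N)
    (Omega_open : open Omega)
    (Omega_bounded : bounded_set Omega)
    (Omega_lipschitz : lipschitz_boundary Omega)
    (Omega0 : Omega 0)
    (p_gt1 : 1 < p) (ltpq : p < q) (ltqN : q < N%:R)
    (qp_bound : q / p < 1 + N%:R^-1)
    (a_ge0 : forall x, closure Omega x -> 0 <= a x)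
    (a_lipschitz : [lipschitz a x | x in closure Omega])
    (* a is extended by 0 outside the closure of Omega *)
    (a_scaling : forall (lambda : R) (x : 'rV[R]_N),
       0 < lambda <= 1 -> closure Omega x ->
       patch (fun=> 0) (closure Omega) a (lambda *: x) <= a x)
    (u : 'rV[R]_N -> R) (grad_u : 'rV[R]_N -> 'rV[R]_N)
    (u_W1H0 : W1H0 Omega p q a u grad_u) :
  ((hardy_const N p)%:E *
      \int[lebesgue_rV R N]_(x in Omega) (`|u x| `^ p / enorm x `^ p)%:E
    <= \int[lebesgue_rV R N]_(x in Omega) (enorm (grad_u x) `^ p)%:E)%E /\
  ((hardy_const N q)%:E *
      \int[lebesgue_rV R N]_(x in Omega) (a x * (`|u x| `^ q / enorm x `^ q))%:E
    <= \int[lebesgue_rV R N]_(x in Omega) (a x * enorm (grad_u x) `^ q)%:E)%E.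
Proof.
have Ocl : Omega `<=` closure Omega := @subset_closure _ Omega.
have ma : measurable_fun Omega (a : 'rV[R]_N -> measurableTypeR R).
  apply: open_continuous_measurable_fun_rV => //.
  exact: lipschitz_continuous_interior a_lipschitz.
have mO := open_measurable_rV Omega_open.
have a0 x : Omega x -> 0 <= a x by move=> /Ocl; exact: a_ge0.
split.
  have E1 (f : 'rV[R]_N -> R) : (\int[lebesgue_rV R N]_(x in Omega) (f x)%:E =
      \int[lebesgue_rV R N]_(x in Omega) (1 * f x)%:E)%E.
    by apply: eq_integral => x _; rewrite mul1r.
  rewrite (E1 (fun x => `|u x| `^ p / enorm x `^ p)).
  rewrite (E1 (fun x => enorm (grad_u x) `^ p)).
  apply: (@hardy_W1H0 R N Omega p q p a (cst 1)) => //.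
  - exact: lt_trans ltqN.
  - move=> x t Ox; rewrite mul1r powR_ge0/= lerDl mulr_ge0 ?powR_ge0//.
    exact: a0.
pose w : 'rV[R]_N -> R := (a : 'rV[R]_N -> measurableTypeR R) \_ Omega.
have wE x : Omega x -> w x = a x by move=> Ox; rewrite /w patchE mem_set.
have w0 x : 0 <= w x.
  by rewrite /w patchE; case: ifPn => // /[!inE]; exact: a0.
have Ew (f : 'rV[R]_N -> R) : (\int[lebesgue_rV R N]_(x in Omega) (a x * f x)%:E =
   \int[lebesgue_rV R N]_(x in Omega) (w x * f x)%:E)%E.
  by apply: eq_integral => x /[!inE] Ox; rewrite wE.
rewrite !Ew; apply: (@hardy_W1H0 R N Omega p q q a) => //.
- exact: lt_trans p_gt1 ltpq.
- exact: (proj1 (measurable_restrictT _ mO) ma).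
- move=> l x l01 Ox; rewrite (wE x)//; have := a_scaling l x l01 (Ocl _ Ox).
  have [Olx|nOlx] := pselect (Omega (l *: x)).
    by rewrite wE// patchE mem_set//; exact: Ocl.
  by move=> _; rewrite /w patchE memNset// a0.
- move=> x t Ox; rewrite wE// mulr_ge0 ?powR_ge0//=; last exact: a0.
  by rewrite lerDr powR_ge0.
Qed.
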